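(* Let $P$ be a law of the observed data $(H_{T-1},A_{T-1},Y)$ with $Y\in\{0,1\}$ satisfying sequential positivity, and let $V^-$ and $V^+$ be the functionals of $P$ defined by the backward recursion in the context. Then: (i) For every joint law of observed and counterfactual variables that is compatible with $P$ (i.e. has observed-data law $P$, with binary potential outcomes, and satisfies sequential consistency, strong sequential exchangeability and the FFRCISTG model), the oracle value $V^{\mathrm{perfect}}=\mathbb{E}\{\sup_{d\in\mathcal{D}}Y(d)\}$ satisfies $$V^-\le V^{\mathrm{perfect}}\le V^+ .$$ (ii) The interval $[V^-,V^+]$ is sharp: there exists a joint law compatible with $P$ under which $V^{\mathrm{perfect}}=V^-$, and there exists a joint law compatible with $P$ under which $V^{\mathrm{perfect}}=V^+$.
   Context: Observed data. Decisions are made at times $t=0,\dots,T-1$ (with $T\ge 1$). At time $t$ a treatment $A_t$ taking values in a finite nonempty set $\mathcal{A}_t$ is assigned. $H_t$ is all information observed before $A_t$: $H_0=L_0$ and $H_{t+1}=(H_t,A_t,L_{t+1})$, where the covariates $L_t$ take values in Euclidean spaces (possibly continuous and of high dimension). After $A_{T-1}$ a final outcome $Y\in\{0,1\}$ is observed, with $1$ the preferred value. Write $\bar a_t=(a_0,\dots,a_t)$ and $\bar A_t=(A_0,\dots,A_t)$ ($\bar A_{-1}$ is empty). Counterfactuals. For every treatment sequence there are counterfactual histories $H_{t+1}(\bar a_t)$, $t=0,\dots,T-2$ (containing $L_0$, the treatments $\bar a_t$ and the counterfactual covariates $L_1(\bar a_0),\dots,L_{t+1}(\bar a_t)$), and outcomes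 $Y(\bar a_{T-1})\in\{0,1\}$. All are defined on one probability space together with the observed variables. Dynamic rules. A dynamic treatment rule $d=(d_0,\dots,d_{T-1})$ consists of (measurable) functions $d_t$ mapping each value of $H_t$ to an element of $\mathcal{A}_t$; $\mathcal{D}$ is the set of all such rules. $Y(d)$ is the counterfactual outcome under $d$: $Y(d)=Y(\bar a_{T-1})$, where $a_0=d_0(H_0)$ and $a_t=d_t(H_t(\bar a_{t-1}))$ for $t\ge1$. Assumptions. - Sequential consistency: $\bar A_t=\bar a_t$ implies $H_{t+1}=H_{t+1}(\bar a_t)$ (for $t\le T-2$), and $\bar A_{T-1}=\bar a_{T-1}$ implies $Y=Y(\bar a_{T-1})$. - Sequential positivity: for every $t$ and every $a\in\mathcal{A}_t$, $\Pr(A_t=a\mid H_t=h_t)>0$ for (almost) every history $h_t$ that can occur under a rule in $\mathcal{D}$. - Strong sequential exchangeability: for $t=0,\dots,T-1$, $A_t$ is conditionally independent, given $H_t$, of the joint collection $\mathcal{C}_t$ consisting of $H_{t+1}(\bar A_{t-1},a_t),\,H_{t+2}(\bar A_{t-1},a_t,a_{t+1}),\dots,Y(\bar A_{t-1},a_t,\dots,a_{T-1})$ for all $a_t,\dots,a_{T-1}$. - FFRCISTG (finest fully randomized causally interpreted structured tree graph) model: the counterfactuals above exist and are restricted only by consistency and sequential exchangeability; no further (cross-world) restriction is placed on the association between counterfactuals in branches following different, mutually incompatible, actions at the same history. Recursion. All expectations are under $P$. Let $m_{T-1}(h,a)=\mathbb{E}(Y\mid H_{T-1}=h,A_{T-1}=a)$,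 and set $$q_{T-1}^-(h,a)=q_{T-1}^+(h,a)=m_{T-1}(h,a),$$ $$v_{T-1}^-(h)=\max_{a\in\mathcal{A}_{T-1}}q_{T-1}^-(h,a),\qquad v_{T-1}^+(h)=\min\Big\{1,\sum_{a\in\mathcal{A}_{T-1}}q_{T-1}^+(h,a)\Big\}.$$ For $t=T-2,\dots,0$ define $$q_t^{\pm}(h,a)=\mathbb{E}\{v_{t+1}^{\pm}(H_{t+1})\mid H_t=h,A_t=a\},$$ $$v_t^-(h)=\max_{a\in\mathcal{A}_t}q_t^-(h,a),\qquad v_t^+(h)=\min\Big\{1,\sum_{a\in\mathcal{A}_t}q_t^+(h,a)\Big\}.$$ Finally $V^-=\mathbb{E}\{v_0^-(H_0)\}$ and $V^+=\mathbb{E}\{v_0^+(H_0)\}$. *)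

(* Defs.v *)
(* MathComp-Analysis. *)
From HB Require Import structures.
From mathcomp Require Import all_boot all_order all_algebra.
From mathcomp Require Import all_classical all_reals all_analysis.
From mathcomp Require Import measurable_realfun.

Set Implicit Arguments.
Unset Strict Implicit.
Unset Printing Implicit Defensive.

Import Order.TTheory GRing.Theory Num.Theory.
Import numFieldNormedType.Exports.

Local Open Scope classical_set_scope.
Local Open Scope ring_scope.

(* A finite nonempty set, the distinguished point being a witness of
   nonemptiness (measurable types are pointed). *)
#[short(type="finPointedType")]
HB.structure Definition FinPointed := {T of Finite T & Pointed T}.

Definition discrete (T : Type) : Type := T.

Section discrete.
Context (T : finPointedType).
HB.instance Definition _ := Finite.on (discrete T).
HB.instance Definition _ := Pointed.on (discrete T).
HB.instance Definition _ := @isMeasurable.Build default_measure_display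
  (discrete T) discrete_measurable discrete_measurable0
  discrete_measurableC discrete_measurableU.
End discrete.

Section conditional_expectation.
Context {R : realType} d d' {T : measurableType d} {S : measurableType d'}.
Variables (P : probability T R) (W : T -> S).

Definition is_cexp (X : T -> R) (q : S -> R) : Prop :=
  [/\ measurable_fun [set: S] q,
      P.-integrable [set: T] (fun w => (q (W w))%:E) &
      forall B, measurable B ->
        (\int[P]_(w in W @^-1` B) (q (W w))%:E =
         \int[P]_(w in W @^-1` B) (X w)%:E)%E].

(* A version of the regression function s |-> E(X | W = s), unique up to a
   null set of the law of W. *)
Definition cexp (X : T -> R) : S -> R := xget (fun=> 0) (is_cexp X).

Definition cprob (E : set T) : S -> R := cexp \1_E.

Lemma cexpP (X : T -> R) : measurable_fun [set: T] W ->
  P.-integrable [set: T] (fun w => (X w)%:E) -> is_cexp X (cexp X).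
Proof.
move=> mW0 iX; have mW := mW0.
pose WW : {mfun T >-> S} := HB.pack W (isMeasurableFun.Build _ _ _ _ _ mW0).
pose mu : probability S R := distribution P WW.
pose nu_ := pushforward (induced_charge iX) W : {charge set S -> \bar R}.
pose nu := nu_ mW0.
have mWB B : measurable B -> measurable (W @^-1` B).
  by move=> mB; rewrite -[X in measurable X]setTI; exact: mW.
have numu : nu `<< mu.
  apply/null_content_dominatesP => B mB PB0.
  have mX : measurable_fun [set: T] (EFin \o X).
    exact: measurable_int iX.
  have := @null_set_integral _ _ _ P _ _ (mWB B mB) (measurable_funTS mX) PB0.
  by [].
pose g := Radon_Nikodym nu mu.
have gfin s : g s \is a fin_num by exact: Radon_Nikodym_fin_num.
have ig : mu.-integrable [set: S] g by exact: Radon_Nikodym_integrable.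
have mg : measurable_fun [set: S] g by exact: measurable_int ig.
have igW : P.-integrable [set: T] (g \o W).
  apply/integrableP; split; first exact: measurableT_comp.
  have /integrableP[_] := ig.
  by rewrite ge0_integral_distribution//; exact: measurableT_comp.
rewrite /cexp; case: xgetP => [q -> //|/(_ (fun s => fine (g s)))[]].
have gE w : (fine (g (W w)))%:E = (g \o W) w by rewrite /= fineK.
split.
- exact: measurableT_comp.
- by under eq_fun do rewrite gE.
- move=> B mB; under eq_integral do rewrite gE.
  rewrite -(@integral_pushforward _ _ _ _ _ W mW P)//.
  + have := Radon_Nikodym_integral numu mB; rewrite -/g => <-.
    by [].
  + exact: (integrableS measurableT (mWB B mB) (@subsetT _ _) igW).
Qed.

(* Conditional independence, given W, of Z and of the sigma-algebra generated
   by the family of events G. *)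
Definition cindep d'' (U : measurableType d'') (Z : T -> U)
    (G : set (set T)) : Prop :=
  forall (B : set U) (E : set T), measurable B -> <<s G >> E ->
    {ae P, forall w, cprob (Z @^-1` B `&` E) (W w) =
                     cprob (Z @^-1` B) (W w) * cprob E (W w)}.

End conditional_expectation.

Section observed_data.
Variables (R : realType) (A : nat -> finPointedType) (k : nat -> nat).

(* L_t lives in R^(k t), with the product of the Borel sigma-algebras. *)
Definition cov_type (t : nat) := (k t).-tuple (measurableTypeR R).
Definition trt_type (t : nat) := discrete (A t).

HB.instance Definition _ t := Measurable.on (cov_type t).
HB.instance Definition _ t := Finite.on (trt_type t).
HB.instance Definition _ t := Measurable.on (trt_type t).

Fixpoint hist_display (t : nat) : measure_display :=
  if t is t'.+1 then
    measure_prod_display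
      (measure_prod_display (hist_display t', default_measure_display),
       measure_tuple_display R.-ocitv.-measurable.-sigma)%mdisp
  else measure_tuple_display R.-ocitv.-measurable.-sigma%mdisp.

Fixpoint hist (t : nat) : measurableType (hist_display t) :=
  if t is t'.+1 return measurableType (hist_display t)
  then (hist t' * trt_type t' * cov_type t'.+1)%type
  else cov_type 0.


(* Observed variables on a sample space T. Throughout, N is the last decision
   time, so that there are N + 1 >= 1 of them; the families below are indexed
   by all of nat, the components beyond N being irrelevant. *)
Record process (T : Type) := Process {
  cov : forall t, T -> cov_type t ;
  trt : forall t, T -> trt_type t ;
  out : T -> bool }.

Fixpoint H T (X : process T) (t : nat) : T -> hist t :=
  if t is t'.+1 return T -> hist t
  then fun w => (H X t' w, trt X t' w, cov X t'.+1 w)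
  else cov X 0.

Definition HA T (X : process T) (t : nat) (w : T) : hist t * trt_type t :=
  (H X t w, trt X t w).

Definition data (N : nat) := (hist N * trt_type N * bool)%type.

(* Coordinates of a history, [point] being returned out of range. *)
Fixpoint hist_cov (n : nat) : hist n -> forall t, cov_type t :=
  if n is n'.+1 return hist n -> forall t, cov_type t
  then fun h => @dfwith _ cov_type (hist_cov h.1.1) n'.+1 h.2
  else fun h => @dfwith _ cov_type (fun=> point) 0 h.

Fixpoint hist_trt (n : nat) : hist n -> forall t, trt_type t :=
  if n is n'.+1 return hist n -> forall t, trt_type t
  then fun h => @dfwith _ trt_type (hist_trt h.1.1) n' h.1.2
  else fun _ _ => point.

(* The coordinate variables on the space of observed data. *)
Definition data_process (N : nat) : process (data N) := {|
  cov := fun t x => hist_cov x.1.1 t ;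
  trt := fun t x => @dfwith _ trt_type (hist_trt x.1.1) N x.1.2 t ;
  out := fun x => x.2 |}.

Definition rule := forall t, hist t -> trt_type t.

Definition rules : set rule :=
  [set d | forall t, measurable_fun [set: hist t] (d t)].

(* h can occur under d: its treatments are those prescribed by d. *)
Fixpoint follows (d : rule) (t : nat) : hist t -> Prop :=
  if t is t'.+1 return hist t -> Prop
  then fun h => follows d h.1.1 /\ h.1.2 = d t' h.1.1
  else fun=> True.

Section law.
Context d0 (T : measurableType d0) (P : probability T R).
Variables (X : process T) (N : nat).

(* "For almost every history" refers to the law of H_t. *)
Definition seq_positivity : Prop :=
  forall d, rules d -> forall t, (t <= N)%N -> forall a : trt_type t,
    {ae P, forall w, follows d (H X t w) ->
       0 < cprob P (H X t) (trt X t @^-1` [set a]) (H X t w)}.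

Section recursion.
Variable agg : forall t, (trt_type t -> R) -> R.

(* [qfun j t] is q_t when t is followed by exactly j further decision times
   (t + j = N), so that q_t is [qfun (N - t) t]. *)
Fixpoint qfun (j t : nat) : hist t * trt_type t -> R :=
  cexp P (HA X t)
    (if j is j'.+1
     then fun w => agg (fun a : trt_type t.+1 => qfun j' (H X t.+1 w, a))
     else fun w => (out X w)%:R).

Definition vfun (j t : nat) (h : hist t) : R :=
  agg (fun a : trt_type t => qfun j (h, a)).

Definition value : \bar R := 'E_P[fun w => vfun N (H X 0 w)].

End recursion.

Definition agg_max t (f : trt_type t -> R) : R :=
  \big[Num.max/f point]_(a : trt_type t) f a.

Definition agg_sum t (f : trt_type t -> R) : R :=
  Num.min 1 (\sum_(a : trt_type t) f a).

Definition V_minus : \bar R := value agg_max.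
Definition V_plus : \bar R := value agg_sum.

End law.

(* The sequences (a_0, ..., a_{t-1}). *)
Fixpoint tseq (t : nat) : Type :=
  if t is t'.+1 then (tseq t' * trt_type t')%type else unit.

Record cf_process (N : nat) (T : Type) := CfProcess {
  obs :> process T ;
  cf_cov : forall t, tseq t.+1 -> T -> cov_type t.+1 ;
  cf_out : tseq N.+1 -> T -> bool }.

Section counterfactuals.
Variables (N : nat) (T : Type) (M : cf_process N T).

(* H_t(a_0, ..., a_{t-1}) *)
Fixpoint cf_hist (t : nat) : tseq t -> T -> hist t :=
  if t is t'.+1 return tseq t -> T -> hist t
  then fun s w => (cf_hist s.1 w, s.2, cf_cov M s w)
  else fun _ => cov M 0.

(* (A_0, ..., A_{t-1}) *)
Fixpoint obs_seq (t : nat) (w : T) : tseq t :=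
  if t is t'.+1 return tseq t then (obs_seq t' w, trt M t' w) else tt.

(* The first t treatments of s are replaced by the observed ones:
   (A_0, ..., A_{t-1}, a_t, ..., a_{n-1}). *)
Fixpoint splice (t n : nat) (w : T) : tseq n -> tseq n :=
  if n is n'.+1 return tseq n -> tseq n
  then fun s => (splice t w s.1, if (n' < t)%N then trt M n' w else s.2)
  else id.

(* The treatments (a_0, ..., a_{t-1}) resulting from following d. *)
Fixpoint rule_seq (d : rule) (t : nat) (w : T) : tseq t :=
  if t is t'.+1 return tseq t
  then let s := rule_seq d t' w in (s, d t' (cf_hist s w))
  else tt.

Definition Yd (d : rule) (w : T) : bool := cf_out M (rule_seq d N.+1 w) w.

Definition seq_consistency : Prop :=
  (forall t, (t < N)%N -> forall (s : tseq t.+1) w,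
     obs_seq t.+1 w = s -> H M t.+1 w = cf_hist s w) /\
  (forall (s : tseq N.+1) w, obs_seq N.+1 w = s -> out M w = cf_out M s w).

(* The events generating the sigma-algebra of the joint collection of
   H_{n+1}(A_0, ..., A_{t-1}, a_t, ..., a_n), t <= n < N, and
   Y(A_0, ..., A_{t-1}, a_t, ..., a_N), for all a_t, ..., a_N. *)
Definition future_events (t : nat) : set (set T) :=
  [set E | (exists n (s : tseq n.+1) (B : set (hist n.+1)),
              [/\ (t <= n < N)%N, measurable B &
                  E = [set w | B (cf_hist (splice t w s) w)]]) \/
           (exists (s : tseq N.+1) (b : bool),
              E = [set w | cf_out M (splice t w s) w = b])].

End counterfactuals.

Section joint_law.
Context (N : nat) d0 (T : measurableType d0) (Q : probability T R).
Variable M : cf_process N T.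

Definition strong_seq_exchangeability : Prop :=
  forall t, (t <= N)%N -> cindep Q (H M t) (trt M t) (future_events M t).

Definition measurable_process : Prop :=
  [/\ forall t, (t <= N)%N -> measurable_fun [set: T] (cov M t),
      forall t, (t <= N)%N -> measurable_fun [set: T] (trt M t),
      measurable_fun [set: T] (out M),
      forall t, (t < N)%N -> forall s : tseq t.+1,
        measurable_fun [set: T] (cf_cov M s) &
      forall s, measurable_fun [set: T] (cf_out M s)].

Definition compatible (P : probability (data N) R) : Prop :=
  [/\ measurable_process,
      forall B : set (data N), measurable B ->
        Q ((fun w => (H M N w, trt M N w, out M w)) @^-1` B) = P B,
      seq_consistency M &
      strong_seq_exchangeability].

Definition V_perfect : \bar R :=
  'E_Q[fun w => sup [set ((Yd M d w)%:R : R) | d in rules]].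

End joint_law.

End observed_data.

(* Main.v *)
Require Import Defs.
From mathcomp Require Import all_boot all_order all_algebra.
From mathcomp Require Import all_classical all_reals all_analysis.
From mathcomp Require Import measurable_realfun.

(** A constant rule realizes any treatment sequence, so [sup_d Y(d)] is the
    maximum of [Y(s)] over the finitely many sequences [s], and the oracle value
    is the probability that some sequence succeeds.

    Bounds: let W_t be the event that some continuation of the observed
    treatments from time t on succeeds, and W_t^a the same with [a_t = a].  On
    [A_t = a], W_t^a is W_(t+1), so exchangeability and positivity give
    [P(W_t^a | H_t) = P(W_(t+1) | H_t, A_t = a)]; as W_t is the union of the
    W_t^a, its conditional probability is at least the maximum and at most the
    truncated sum of these, and backward induction concludes.

    Sharpness: every counterfactual path carries a pair (h_t, u_t) with u_t
    uniform given h_t along the observed path.  The event [u_t < v_t(h_t)] is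
    cut into events [u_t \in I_a] of conditional probability q_t(h_t, a) whose
    union it is: nested intervals for the lower bound, intervals that overlap
    only when they have to for the upper one.  For each a, the pair
    (h_(t+1), u_(t+1)) is drawn so that [u_(t+1) < v_(t+1)(h_(t+1))] coincides
    with [u_t \in I_a], and Y is [u_N \in I_a].  Hence some sequence succeeds if
    and only if [u_0 < v_0(h_0)], an event of probability E v_0(H_0).  The draws
    are functions of independent uniform variables, and A_t depends only on H_t
    and on a noise variable of its own, whence exchangeability. *)

Set Implicit Arguments.
Unset Strict Implicit.
Unset Printing Implicit Defensive.

Import Order.TTheory GRing.Theory Num.Theory.
Import numFieldNormedType.Exports.

Local Open Scope classical_set_scope.
Local Open Scope ring_scope.

(** * Conditional expectations *)

(** Two obstacles shape the proof. Regressions are determined only up to null sets of the law of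
    (H_t, A_t), whereas v_t(h) reads q_t(h, a) at every a; positivity bridges the gap ([ae_HA]), and
    regressions are clamped to [0, 1] so that later arguments hold pointwise. Moreover all
    counterfactuals must live on one space at once, so conditional laws are realised by measurable
    functions of an extra noise rather than by kernels. Sharpness rests on a coincidence of
    probabilities: given (H_t, A_t), the events [u_t \in I_a] for a = A_t and
    [u_(t+1) < v_(t+1)(H_(t+1))] both have conditional probability q_t(H_t, A_t). The law of
    (L_(t+1), u_(t+1)) given H_t, A_t and the second event can therefore be sampled with the first
    event in place of the second, and the observed law is unchanged. The maximum and the truncated
    sum are instances of one abstract aggregator, so that validity and sharpness are each proved
    once. *)

Lemma measurable_pred d (T : measurableType d) (f : T -> bool) :
  measurable_fun [set: T] f -> measurable [set x | f x].
Proof.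
move=> /(_ measurableT [set true]); rewrite setTI; apply.
by rewrite /measurable/=.
Qed.

Lemma measurable_preim d d' (T : measurableType d) (S : measurableType d')
    (f : T -> S) B :
  measurable_fun [set: T] f -> measurable B -> measurable (f @^-1` B).
Proof. by move=> mf mB; rewrite -[X in measurable X]setTI; exact: mf. Qed.

Section unit_interval.
Context {R : realType}.

(** A version of the regression of a [0, 1]-valued variable has its values in [0, 1] only almost
    everywhere; composing it with [clamp] gives another version, bounded everywhere. *)
Definition clamp (x : R) : R := Num.max 0 (Num.min 1 x).

Lemma clamp_ge0 x : 0 <= clamp x.
Proof. by rewrite /clamp le_max lexx. Qed.

Lemma clamp_le1 x : clamp x <= 1.
Proof. by rewrite /clamp ge_max ler01 ge_min lexx. Qed.

Lemma clamp_id x : 0 <= x <= 1 -> clamp x = x.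
Proof. by case/andP=> x0 x1; rewrite /clamp (min_idPr x1) (max_idPr x0). Qed.

Lemma measurable_clamp d (T : measurableType d) (f : T -> R) :
  measurable_fun [set: T] f -> measurable_fun [set: T] (clamp \o f).
Proof. by move=> mf; apply: measurable_maxr => //; exact: measurable_minr. Qed.

Lemma integrable01 d (T : measurableType d) (P : probability T R)
    (D : set T) (f : T -> R) : measurable D -> measurable_fun [set: T] f ->
  (forall x, 0 <= f x <= 1) -> P.-integrable D (EFin \o f).
Proof.
move=> mD mf f01; apply: (integrableS measurableT) => //.
apply: (@le_integrable _ _ _ _ _ measurableT _ (cst 1%E)).
- exact/measurable_EFinP.
- by move=> x _ /=; rewrite !lee_fin normr1 ger0_norm; case/andP: (f01 x).
- exact: finite_measure_integrable_cst.
Qed.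

End unit_interval.

Section conditional_expectation.
Context {R : realType} {d d'} {T : measurableType d} {S : measurableType d'}.
Variables (P : probability T R) (W : T -> S).
Hypothesis mW : measurable_fun [set: T] W.

Let mWB B : measurable B -> measurable (W @^-1` B).
Proof. exact: measurable_preim. Qed.

(** On the event where g < f the positive difference f - g has integral at most 0, so this event is
    null. *)
Lemma ae_le_of_integral (f g : S -> R) :
  measurable_fun [set: S] f -> measurable_fun [set: S] g ->
  P.-integrable [set: T] (fun w => (f (W w))%:E) ->
  P.-integrable [set: T] (fun w => (g (W w))%:E) ->
  (forall B, measurable B -> (\int[P]_(w in W @^-1` B) (f (W w))%:E <=
                              \int[P]_(w in W @^-1` B) (g (W w))%:E)%E) ->
  {ae P, forall w, f (W w) <= g (W w)}.
Proof.
move=> mf mg intf intg fg.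
pose B := [set s | g s < f s].
have mB : measurable B.
  exact/measurable_pred/measurable_fun_ltr.
have mD := mWB mB.
have ifB := integrableS measurableT mD (@subsetT _ _) intf.
have igB := integrableS measurableT mD (@subsetT _ _) intg.
have i0 : (\int[P]_(w in W @^-1` B) `|(f (W w) - g (W w))%:E|)%E = 0%E.
  apply/eqP; rewrite eq_le integral_ge0 ?andbT; last by move=> ? _; exact: abse_ge0.
  rewrite (eq_integral (fun w => (f (W w))%:E - (g (W w))%:E)%E); last first.
    move=> w; rewrite inE /B/= => wB; rewrite ger0_norm// subr_ge0 ltW//.
  rewrite integralB// sube_le0; exact: fg.
have mfg : measurable_fun (W @^-1` B) (fun w => (f (W w) - g (W w))%:E).
  apply/measurable_EFinP; apply: measurable_funTS.
  by apply: measurable_funB; exact: measurableT_comp.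
move/(ae_eq_integral_abs P mD mfg): i0.
apply: filterS => w; apply: contraPP => /negP; rewrite -ltNge => wB /(_ wB).
by move=> /= [] /eqP; rewrite subr_eq0 => /eqP fgE; rewrite fgE ltxx in wB.
Qed.

Lemma ae_eq_of_integral (f g : S -> R) :
  measurable_fun [set: S] f -> measurable_fun [set: S] g ->
  P.-integrable [set: T] (fun w => (f (W w))%:E) ->
  P.-integrable [set: T] (fun w => (g (W w))%:E) ->
  (forall B, measurable B -> (\int[P]_(w in W @^-1` B) (f (W w))%:E =
                              \int[P]_(w in W @^-1` B) (g (W w))%:E)%E) ->
  {ae P, forall w, f (W w) = g (W w)}.
Proof.
move=> mf mg intf intg fg.
have fleg : {ae P, forall w, f (W w) <= g (W w)}.
  by apply: ae_le_of_integral => // B mB; rewrite fg.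
have glef : {ae P, forall w, g (W w) <= f (W w)}.
  by apply: ae_le_of_integral => // B mB; rewrite fg.
by apply: filterS2 fleg glef => w h1 h2; apply/eqP; rewrite eq_le h1.
Qed.

Lemma is_cexp_ae_eq (X : T -> R) (f g : S -> R) :
  is_cexp P W X f -> measurable_fun [set: S] g ->
  {ae P, forall w, f (W w) = g (W w)} -> is_cexp P W X g.
Proof.
move=> [mf intf fE] mg fg.
have mgW : measurable_fun [set: T] (fun w => (g (W w))%:E).
  by apply/measurable_EFinP; exact: measurableT_comp.
have mfW : measurable_fun [set: T] (fun w => (f (W w))%:E) by exact: measurable_int intf.
have aefg D : ae_eq P D (fun w => (f (W w))%:E) (fun w => (g (W w))%:E).
  by apply: filterS fg => w /= ->.
split=> //.
  apply/integrableP; split=> //; have /integrableP[_] := intf.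
  rewrite (_ : (\int[P]_w _)%E = (\int[P]_w `|(g (W w))%:E|)%E)//.
  apply: ae_eq_integral => //; [exact: measurableT_comp..|].
  by apply: filterS fg => w /= ->.
move=> B mB; rewrite -fE//; apply/esym/ae_eq_integral => //; first exact: mWB.
all: exact: measurable_funTS.
Qed.

Lemma is_cexp_unique (X : T -> R) (f g : S -> R) :
  is_cexp P W X f -> is_cexp P W X g -> {ae P, forall w, f (W w) = g (W w)}.
Proof.
move=> [mf intf fE] [mg intg gE]; apply: ae_eq_of_integral => // B mB.
by rewrite fE// gE.
Qed.

Lemma is_cexp_ae_eqX (X Y : T -> R) (f : S -> R) :
  is_cexp P W X f -> measurable_fun [set: T] X -> measurable_fun [set: T] Y ->
  {ae P, forall w, X w = Y w} -> is_cexp P W Y f.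
Proof.
move=> [mf intf fE] mX mY XY; split=> // B mB; rewrite fE//.
apply: ae_eq_integral => //; first exact: mWB.
- by apply/measurable_EFinP; exact: measurable_funTS.
- by apply/measurable_EFinP; exact: measurable_funTS.
- by apply: filterS XY => w /= ->.
Qed.

Lemma is_cexp_ae01 (X : T -> R) (f : S -> R) : measurable_fun [set: T] X ->
  (forall w, 0 <= X w <= 1) -> is_cexp P W X f ->
  {ae P, forall w, 0 <= f (W w) <= 1}.
Proof.
move=> mX X01 [mf intf fE].
have cst_int (c : R) : P.-integrable [set: T] (fun=> c%:E).
  exact: finite_measure_integrable_cst.
have XD D : measurable D -> P.-integrable D (EFin \o X).
  by move=> mD; exact: integrable01.
have f0 : {ae P, forall w, 0 <= f (W w)}.
  apply: (@ae_le_of_integral (cst 0) f) => //.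
    exact: cst_int.
  move=> B mB; rewrite fE//.
  apply: le_integral => //; [exact: mWB| |exact/XD/mWB|].
    by apply: integrableS (cst_int 0) => //; exact: mWB.
  by move=> w _; rewrite lee_fin; case/andP: (X01 w).
have f1 : {ae P, forall w, f (W w) <= 1}.
  apply: (@ae_le_of_integral f (cst 1)) => //.
    exact: cst_int.
  move=> B mB; rewrite fE//.
  apply: le_integral => //; [exact: mWB|exact/XD/mWB| |].
    by apply: integrableS (cst_int 1) => //; exact: mWB.
  by move=> w _; rewrite lee_fin; case/andP: (X01 w).
by apply: filterS2 f0 f1 => w -> ->.
Qed.

Lemma is_cexp_clamp (X : T -> R) (f : S -> R) : measurable_fun [set: T] X ->
  (forall w, 0 <= X w <= 1) -> is_cexp P W X f -> is_cexp P W X (clamp \o f).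
Proof.
move=> mX X01 cf; apply: (is_cexp_ae_eq cf).
  by apply: measurable_clamp; case: cf.
by apply: filterS (is_cexp_ae01 mX X01 cf) => w f01; rewrite /= clamp_id.
Qed.

Lemma cexp01P (X : T -> R) : measurable_fun [set: T] X ->
  (forall w, 0 <= X w <= 1) -> is_cexp P W X (cexp P W X).
Proof. by move=> mX X01; apply: cexpP => //; exact: integrable01. Qed.

Lemma cprobP (E : set T) : measurable E -> is_cexp P W \1_E (cprob P W E).
Proof.
move=> mE; apply: cexp01P; first exact: measurable_indic.
by move=> w; rewrite indicE ler0n lern1 leq_b1.
Qed.

End conditional_expectation.

(** * Laws and product measures *)

Section law.
Context {R : realType} {d} {S : measurableType d}.

Definition same_law d1 (T1 : measurableType d1) (P1 : probability T1 R)
    (X1 : T1 -> S) d2 (T2 : measurableType d2) (P2 : probability T2 R)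
    (X2 : T2 -> S) :=
  forall B, measurable B -> P1 (X1 @^-1` B) = P2 (X2 @^-1` B).

Context d1 (T1 : measurableType d1) (P1 : probability T1 R) (X1 : T1 -> S).
Context d2 (T2 : measurableType d2) (P2 : probability T2 R) (X2 : T2 -> S).

Lemma same_law_comp d' (S' : measurableType d') (f : S -> S') :
  measurable_fun [set: S] f -> same_law P1 X1 P2 X2 ->
  forall B, measurable B ->
    P1 ((f \o X1) @^-1` B) = P2 ((f \o X2) @^-1` B).
Proof. by move=> mf X12 B mB; exact: (X12 _ (measurable_preim mf mB)). Qed.

Lemma same_law_integral (f : S -> \bar R) :
  measurable_fun [set: T1] X1 -> measurable_fun [set: T2] X2 ->
  same_law P1 X1 P2 X2 ->
  measurable_fun [set: S] f -> (forall x, 0 <= f x)%E ->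
  (\int[P1]_x f (X1 x) = \int[P2]_x f (X2 x))%E.
Proof.
move=> mX1 mX2 X12 mf f0.
have := @ge0_integral_pushforward _ _ _ _ _ _ mX1 P1 _ f measurableT mf (in1W f0).
have := @ge0_integral_pushforward _ _ _ _ _ _ mX2 P2 _ f measurableT mf (in1W f0).
rewrite !preimage_setT => <- <-.
apply: eq_measure_integral => A mA _; exact: X12.
Qed.

End law.

Section product.
Context {R : realType} {d1 d2} {T1 : measurableType d1} {T2 : measurableType d2}.
Variables (P1 : probability T1 R) (P2 : probability T2 R).
Local Open Scope ereal_scope.

Lemma product1E B : (P1 \x P2) B = \int[P1]_x P2 [set y | B (x, y)].
Proof.
rewrite /product_measure1; apply: eq_integral => x _ /=; congr (P2 _).
by apply/seteqP; split=> y; rewrite /xsection/= inE.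
Qed.

Lemma measurable_section1 (B : set (T1 * T2)) x :
  measurable B -> measurable [set y | B (x, y)].
Proof. by move=> mB; exact: (measurable_preim (pair1_measurable x)). Qed.

Lemma measurable_section2 (B : set (T1 * T2)) y :
  measurable B -> measurable [set x | B (x, y)].
Proof. by move=> mB; exact: (measurable_preim (pair2_measurable y)). Qed.

Lemma measurable_prob_section1 (B : set (T1 * T2)) : measurable B ->
  measurable_fun [set: T1] (fun x => P2 [set y | B (x, y)]).
Proof.
move=> mB; rewrite (_ : (fun x => _) = P2 \o xsection B).
  exact: measurable_fun_xsection.
apply/funext => x /=; congr (P2 _).
by apply/seteqP; split=> y; rewrite /xsection/= inE.
Qed.

Lemma product2E B : measurable B ->
  (P1 \x P2) B = \int[P2]_y P1 [set x | B (x, y)].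
Proof.
move=> mB; rewrite /product_measure1 -indic_fubini_tonelli_FE//.
rewrite indic_fubini_tonelli//.
rewrite indic_fubini_tonelli_GE//; apply: eq_integral => y _ /=; congr (P1 _).
by apply/seteqP; split=> x; rewrite /ysection/= inE.
Qed.

Lemma product_fst B : measurable B -> (P1 \x P2) (fst @^-1` B) = P1 B.
Proof.
move=> mB; rewrite -setXT product_measure1E//.
by rewrite [X in _ * X]probability_setT mule1.
Qed.

End product.

Section product_law.
Context {R : realType}.
Local Open Scope ereal_scope.

(** By Fubini both sides integrate the same section probability, a function of the S-valued variable
    alone. *)
Lemma same_law_product d (S : measurableType d)
    d1 (T1 : measurableType d1) (P1 : probability T1 R) (X1 : T1 -> S)
    d2 (T2 : measurableType d2) (P2 : probability T2 R) (X2 : T2 -> S)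
    d' (V : measurableType d') (K : probability V R) :
  measurable_fun [set: T1] X1 -> measurable_fun [set: T2] X2 ->
  same_law P1 X1 P2 X2 ->
  same_law (P1 \x K) (fun z => (X1 z.1, z.2)) (P2 \x K) (fun z => (X2 z.1, z.2)).
Proof.
move=> mX1 mX2 X12 B mB; rewrite [LHS]product1E [RHS]product1E/=.
apply: (@same_law_integral _ _ _ _ _ P1 X1 _ _ P2 X2 (fun s => K [set y | B (s, y)])) => //.
exact: measurable_prob_section1.
Qed.

Context d1 (T1 : measurableType d1) (P1 : probability T1 R)
  d2 (T2 : measurableType d2) (P2 : probability T2 R)
  d3 (T3 : measurableType d3) (P3 : probability T3 R).

Lemma product_assoc :
  same_law ((P1 \x P2) \x P3) (fun z => (z.1.1, (z.1.2, z.2))) (P1 \x (P2 \x P3)) id.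
Proof.
move=> B mB; rewrite [LHS]product1E [RHS]product1E/=.
pose f (z : T1 * T2) := P3 [set y | B (z.1, (z.2, y))].
rewrite [LHS](@fubini_tonelli1 _ _ _ _ _ P1 P2 f)//.
  by apply: eq_integral => x _; rewrite [RHS]product1E.
apply: (@measurable_prob_section1 _ _ _ _ _ P3 [set u | B (u.1.1, (u.1.2, u.2))]).
apply: measurable_preim mB.
apply: measurable_fun_pair; first exact: measurableT_comp.
by apply: measurable_fun_pair => //; exact: measurableT_comp.
Qed.

End product_law.

Section product_swap.
Context {R : realType}.
Local Open Scope ereal_scope.
Context d1 (T1 : measurableType d1) (P1 : probability T1 R)
  d2 (T2 : measurableType d2) (P2 : probability T2 R)
  d3 (T3 : measurableType d3) (P3 : probability T3 R).

(** Used to bring a freshly drawn variable next to the factor on which it is to act. *)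
Lemma product_swapA :
  same_law ((P1 \x P2) \x P3) (fun z => ((z.1.1, z.2), z.1.2)) ((P1 \x P3) \x P2) id.
Proof.
move=> B mB; rewrite [LHS]product1E [RHS](product2E _ _ mB)/=.
pose f (z : T1 * T2) := P3 [set y | B ((z.1, y), z.2)].
have mf : measurable_fun [set: T1 * T2] f.
  apply: (@measurable_prob_section1 _ _ _ _ _ P3 [set u | B ((u.1.1, u.2), u.1.2)]).
  apply: measurable_preim mB.
  apply: measurable_fun_pair; last exact: measurableT_comp.
  by apply: measurable_fun_pair => //; exact: measurableT_comp.
have f0 z : 0 <= f z by [].
have E1 := @fubini_tonelli1 _ _ _ _ _ P1 P2 f mf f0.
have E2 := @fubini_tonelli _ _ _ _ _ P1 P2 f mf f0.
apply: (eq_trans E1); apply: (eq_trans E2).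
by apply: eq_integral => y _; rewrite [RHS]product1E.
Qed.

End product_swap.

Section uniform.
Context {R : realType}.
Local Open Scope ereal_scope.

Definition unif : probability (measurableTypeR R) R := uniform_prob (@ltr01 R).

Lemma unif_co (m l : R) : (0 <= m)%R -> (0 <= l)%R -> (m + l <= 1)%R ->
  unif [set u | m <= u < m + l]%R = l%:E.
Proof.
move=> m0 l0 ml1; rewrite /unif/= /uniform_prob.
have -> : [set u | m <= u < m + l]%R = `[m, (m + l)%R[%classic.
  by apply/seteqP; split=> u /=; rewrite in_itv.
rewrite integral_uniform_pdf setIidl; last first.
  move=> u /=; rewrite !in_itv/= => /andP[mu ul]; apply/andP; split.
    exact: le_trans mu.
  exact/ltW/(lt_le_trans ul).
rewrite (eq_integral (cst 1)); last first.
  move=> u; rewrite inE/= in_itv/= => /andP[mu ul].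
  rewrite /uniform_pdf (le_trans m0 mu) (ltW (lt_le_trans ul ml1)) subr0 invr1//.
rewrite integral_cst//= mul1e lebesgue_measure_itv/= lte_fin.
case: ltP => [|ml]; first by rewrite -EFinD addrAC subrr add0r.
by congr (_%:E); apply/eqP; rewrite eq_le l0/= -(lerD2l m) addr0 ml.
Qed.

Lemma unif_ge0 : unif [set u | 0 <= u]%R = 1.
Proof.
apply/eqP; rewrite eq_le probability_le1/=; last first.
  by apply: measurable_pred; exact: measurable_fun_ler.
rewrite -[leLHS](@unif_co 0 1)// ?add0r//; apply: le_measure; rewrite ?inE.
- apply: measurable_pred; apply: measurable_and; first exact: measurable_fun_ler.
  exact: measurable_fun_ltr.
- by apply: measurable_pred; exact: measurable_fun_ler.
- by move=> u /= /andP[].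
Qed.

Lemma unif_lt0 : unif [set u | u < 0]%R = 0.
Proof.
have m0 : measurable [set u : measurableTypeR R | (u < 0)%R].
  by apply: measurable_pred; exact: measurable_fun_ltr.
rewrite -[LHS]/(unif _) (_ : [set u | _] = ~` [set u : R | (0 <= u)%R]).
  by rewrite probability_setC ?unif_ge0 ?subee//; apply: measurable_pred; exact: measurable_fun_ler.
by apply/seteqP; split=> u /=; rewrite ltNge => /negP.
Qed.

(** The negative half-line is null for the uniform law; adding it matches the form of [in_part]. *)
Lemma unif_co' (m l : R) : (0 <= m)%R -> (0 <= l)%R -> (m + l <= 1)%R ->
  unif [set u | ((u < 0) || (m <= u < m + l))%R] = l%:E.
Proof.
move=> m0 l0 ml1; rewrite -[RHS](unif_co m0 l0 ml1).
have m1 : measurable [set u : measurableTypeR R | (u < 0)%R].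
  by apply: measurable_pred; exact: measurable_fun_ltr.
have m2 : measurable [set u : measurableTypeR R | (m <= u < m + l)%R].
  apply: measurable_pred; apply: measurable_and; first exact: measurable_fun_ler.
  exact: measurable_fun_ltr.
rewrite (_ : [set u | _] = [set u : R | (u < 0)%R] `|` [set u : R | (m <= u < m + l)%R]).
  rewrite measureU//; last first.
    apply/seteqP; split=> u //= [u0 /andP[mu _]].
    by have := lt_le_trans u0 (le_trans m0 mu); rewrite ltxx.
  by rewrite [X in X + _]unif_lt0 add0e.
by apply/seteqP; split=> u /=; [move=> /orP[]; [left|right]|case=> ->//; rewrite orbT].
Qed.

Lemma unif_lt (x : R) : (0 <= x <= 1)%R -> unif [set u | u < x]%R = x%:E.
Proof.
move=> /andP[x0 x1]; rewrite -[RHS](@unif_co' 0 x) ?add0r//; congr (unif _).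
apply/seteqP; split=> u /=; first by move=> ux; case: ltP => //= _; exact: ux.
by case: ltP => //= u0 _; exact: lt_le_trans x0.
Qed.

End uniform.

Lemma in_setb (T : Type) (p : T -> bool) (x : T) : (x \in [set y | p y]) = p x.
Proof. by apply/idP/idP; rewrite inE. Qed.

Section pull_out.
Context {R : realType} {d d'} {T : measurableType d} {S : measurableType d'}.
Variables (P : probability T R) (W : T -> S).
Hypothesis mW : measurable_fun [set: T] W.
Local Open Scope ereal_scope.

(** An integral is the measure of the region under the graph. *)
Lemma product_ltE (g : T -> R) (B : set T) :
  measurable B -> measurable_fun [set: T] g -> (forall x, 0 <= g x <= 1)%R ->
  (P \x unif) [set z | B z.1 /\ (z.2 < g z.1)%R] = \int[P]_(x in B) (g x)%:E.
Proof.
move=> mB mg g01; rewrite product1E/= [RHS]integral_mkcond/=.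
apply: eq_integral => x _; rewrite patchE; case: ifPn; rewrite ?(inE, notin_setE) => Bx.
  by rewrite -[RHS]unif_lt//; congr (unif _); apply/seteqP; split=> u /= => [[]|].
rewrite (_ : [set y | _] = set0) ?measure0//.
by apply/seteqP; split=> u //= [].
Qed.

(* The weight g(W) is replaced by the event [u < g(W)], u being uniform and
   independent, and Fubini reduces to the identity defining f. *)
Lemma is_cexp_pull_out (E : set T) (f g : S -> R) :
  measurable E -> is_cexp P W \1_E f -> (forall s, 0 <= f s <= 1)%R ->
  measurable_fun [set: S] g -> (forall s, 0 <= g s <= 1)%R ->
  forall B, measurable B ->
  \int[P]_(w in W @^-1` B) (f (W w) * g (W w))%:E =
  \int[P]_(w in (W @^-1` B) `&` E) (g (W w))%:E.
Proof.
move=> mE [mf intf fE] f01 mg g01 B mB.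
have mWB := measurable_preim mW mB.
have mgW : measurable_fun [set: T] (g \o W) by exact: measurableT_comp.
have mBg u : measurable (B `&` [set s | u < g s]%R).
  by apply: measurableI => //; apply: measurable_pred; exact: measurable_fun_ltr.
pose F (z : T * measurableTypeR R) : \bar R :=
  (if (W z.1 \in B) && (z.2 < g (W z.1))%R then f (W z.1) else 0)%:E.
have mF : measurable_fun [set: T * measurableTypeR R] F.
  apply/measurable_EFinP; apply: measurable_fun_ifT => //.
  - apply: measurable_and.
      apply: (measurable_fun_bool true); rewrite setTI.
      rewrite (_ : _ @^-1` _ = (fst @^-1` (W @^-1` B)))//.
        exact: measurable_preim.
      by apply/seteqP; split=> z /=; [move/set_mem|move/mem_set].
    apply: measurable_fun_ltr => //.
    by apply: (measurableT_comp mgW).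
  - apply: (measurableT_comp mf); exact: (measurableT_comp mW).
have F0 z : 0 <= F z.
  by rewrite /F lee_fin; case: ifP => // _; case/andP: (f01 (W z.1)).
have mlt (x : T) : measurable [set u : measurableTypeR R | (u < g (W x))%R].
  by apply: measurable_pred; exact: measurable_fun_ltr.
transitivity (\int[P]_x \int[unif]_u F (x, u)).
  rewrite integral_mkcond; apply: eq_integral => x _; rewrite patchE /F/=.
  have -> : (W x \in B) = (x \in W @^-1` B) by apply/idP/idP; rewrite !inE.
  case: ifPn => xB /=; last by rewrite integral0.
  rewrite (@eq_integral _ _ _ unif _ (fun u =>
    (f (W x))%:E * (\1_[set u | (u < g (W x))%R] u)%:E)); last first.
    move=> u _; rewrite -EFinM; congr (_%:E); rewrite indicE in_setb.
    by case: ifP; rewrite ?mulr1 ?mulr0.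
  rewrite ge0_integralZl//.
  - by rewrite integral_indic// setIT EFinM; congr (_ * _); rewrite -(unif_lt (g01 (W x))).
  - exact/measurable_EFinP/measurable_indic.
  - by rewrite lee_fin; case/andP: (f01 (W x)).
have E2 := @fubini_tonelli _ _ _ _ _ P unif F mF F0.
apply: (eq_trans E2).
transitivity (\int[unif]_u P (W @^-1` (B `&` [set s | u < g s]%R) `&` E)).
  apply: eq_integral => u _.
  rewrite setIC -integral_indic//; last exact: measurable_preim.
  rewrite -fE// [RHS]integral_mkcond; apply: eq_integral => x _.
  rewrite patchE /F/= (_ : (x \in _) = (W x \in B) && (u < g (W x))%R); first by case: ifP.
  apply/idP/idP => [/set_mem [Bx ->]|/andP[/set_mem Bx gx]]; last exact: mem_set.
  by rewrite andbT; exact: mem_set.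
rewrite -(product_ltE (measurableI _ _ mWB mE) mgW (fun x => g01 (W x))).
have mBE : measurable [set z : T * measurableTypeR R |
    (W @^-1` B `&` E) z.1 /\ (z.2 < g (W z.1))%R].
  apply: (@measurableI _ _ (fst @^-1` (W @^-1` B `&` E)) [set z | (z.2 < g (W z.1))%R]).
    by apply: measurable_preim => //; exact: measurableI.
  apply: measurable_pred; apply: measurable_fun_ltr => //.
  exact: (measurableT_comp mgW).
rewrite [RHS](product2E _ _ mBE).
by apply: eq_integral => u _; congr (P _); apply/seteqP; split=> w /=; tauto.
Qed.

End pull_out.

(** * Laws determined on a pi-system *)

Section dynkin.
Context {R : realType} {d} {S : measurableType d}.
Context d1 (T1 : measurableType d1) (P1 : probability T1 R) (X1 : T1 -> S).
Context d2 (T2 : measurableType d2) (P2 : probability T2 R) (X2 : T2 -> S).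
Hypotheses (mX1 : measurable_fun [set: T1] X1) (mX2 : measurable_fun [set: T2] X2).

(** The events D1 and D2 hold a constraint on another coordinate, so that the pi-lambda theorem can
    be applied to one coordinate of a pair at a time. *)
Lemma dynkin_law (D1 : set T1) (D2 : set T2) (G : set (set S)) :
  measurable D1 -> measurable D2 -> @measurable _ S = <<s G >> ->
  setI_closed G -> P1 D1 = P2 D2 ->
  (forall A, G A -> P1 (D1 `&` X1 @^-1` A) = P2 (D2 `&` X2 @^-1` A)) ->
  forall A, measurable A -> P1 (D1 `&` X1 @^-1` A) = P2 (D2 `&` X2 @^-1` A).
Proof.
move=> mD1 mD2 mG GI D12 GE; rewrite mG.
have aux d0 (T : measurableType d0) (P : probability T R) D (X : T -> S) B :
    measurable D -> measurable_fun [set: T] X -> measurable B ->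
    P (D `&` X @^-1` (~` B)) = (P D - P (D `&` X @^-1` B))%E.
  move=> mD mX mB; rewrite preimage_setC -setDE measureD//; first exact: measurable_preim.
  by rewrite ltey_eq fin_num_measure.
apply: (dynkin_induction mG GI) => //.
- by rewrite !preimage_setT !setIT.
- by move=> B mB BE; rewrite !aux// D12; congr (_ - _)%E.
- move=> F mF tF FE; rewrite !preimage_bigcup !setI_bigcupr.
  have aux2 d0 (T : measurableType d0) (P : probability T R) D (X : T -> S) :
    measurable D -> measurable_fun [set: T] X ->
    P (\bigcup_i (D `&` X @^-1` F i)) = (\sum_(0 <= i <oo) P (D `&` X @^-1` F i))%E.
    move=> mD mX; rewrite measure_bigcup//.
    + by apply: eq_eseriesl => i; rewrite in_setT.
    + by move=> i _; apply: measurableI => //; exact: measurable_preim.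
    + by move=> i j _ _ [w [[_ Fi] [_ Fj]]]; apply: (tF i j) => //; exists (X w).
  by rewrite !aux2//; apply: eq_eseriesr => i _; exact: FE.
Qed.

End dynkin.

Section dynkin_prod.
Context {R : realType} {d d'} {S : measurableType d} {S' : measurableType d'}.
Context d1 (T1 : measurableType d1) (P1 : probability T1 R)
  (X1 : T1 -> S) (Y1 : T1 -> S').
Context d2 (T2 : measurableType d2) (P2 : probability T2 R)
  (X2 : T2 -> S) (Y2 : T2 -> S').
Hypotheses (mX1 : measurable_fun [set: T1] X1) (mX2 : measurable_fun [set: T2] X2).
Hypotheses (mY1 : measurable_fun [set: T1] Y1) (mY2 : measurable_fun [set: T2] Y2).

(** [dynkin_law] is used twice: from G to all measurable sets of the second coordinate, the first
    being constrained to A, then from rectangles to the product sigma-algebra. *)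
Lemma same_law_pair (G : set (set S')) :
  @measurable _ S' = <<s G >> -> setI_closed G ->
  same_law P1 X1 P2 X2 ->
  (forall A B, measurable A -> G B ->
    P1 (X1 @^-1` A `&` Y1 @^-1` B) = P2 (X2 @^-1` A `&` Y2 @^-1` B)) ->
  same_law P1 (fun w => (X1 w, Y1 w)) P2 (fun w => (X2 w, Y2 w)).
Proof.
move=> mG GI X12 GE B mB.
have rect A C : measurable A -> measurable C ->
    P1 (X1 @^-1` A `&` Y1 @^-1` C) = P2 (X2 @^-1` A `&` Y2 @^-1` C).
  move=> mA mC; apply: (dynkin_law mY1 mY2 _ _ mG GI) => //.
  - exact: measurable_preim.
  - exact: measurable_preim.
  - exact: X12.
  - by move=> C' GC'; exact: GE.
rewrite -[X in P1 X]setTI -[X in P2 X]setTI.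
apply: (dynkin_law _ _ _ _ (@measurable_prod_measurableType _ _ S S')) => //.
- exact: measurable_fun_pair.
- exact: measurable_fun_pair.
- move=> _ _ [A1 mA1 [A2 mA2 <-]] [C1 mC1 [C2 mC2 <-]].
  exists (A1 `&` C1); first exact: measurableI.
  by exists (A2 `&` C2); [exact: measurableI|rewrite setXI].
- by rewrite !probability_setT.
- by move=> _ [A mA [C mC <-]]; rewrite !setTI; exact: rect.
Qed.

End dynkin_prod.

(** * Noise outsourcing *)

(* This replaces regular conditional distributions of S'-valued variables. *)
Definition outsourced {R : realType} {dx} {Xi : measurableType dx}
    (K : probability Xi R) {d'} (S' : measurableType d') : Prop :=
  forall d (T : measurableType d) (P : probability T R)
    ds (S : measurableType ds) (W : T -> S) (X : T -> S'),
  measurable_fun [set: T] W -> measurable_fun [set: T] X ->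
  exists2 G : S * Xi -> S', measurable_fun [set: S * Xi] G &
    same_law P (fun w => (W w, X w))
      (P \x K)%E (fun z => (W z.1, G (W z.1, z.2))).

(** * Real variables: the conditional quantile transform *)

Section outsourced_real.
Context {R : realType} {d ds} {T : measurableType d} {S : measurableType ds}.
Variables (P : probability T R) (W : T -> S) (X : T -> R).
Hypotheses (mW : measurable_fun [set: T] W) (mX : measurable_fun [set: T] X).

Let lt_event (x : R) : set T := [set w | X w < x].

Let mlt_event x : measurable (lt_event x).
Proof. by apply: measurable_pred; exact: measurable_fun_ltr. Qed.

Let cdf (x : R) : S -> R := clamp \o cprob P W (lt_event x).

Let cdf01 x s : 0 <= cdf x s <= 1.
Proof. by rewrite clamp_ge0 clamp_le1. Qed.

Let cdfP x : is_cexp P W \1_(lt_event x) (cdf x).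
Proof.
apply: (is_cexp_clamp mW _ _ (cprobP P mW (mlt_event x))) => [|w].
  exact: (measurable_indic (mlt_event x)).
by rewrite indicE ler0n lern1 leq_b1.
Qed.

Let mcdf x : measurable_fun [set: S] (cdf x).
Proof. by case: (cdfP x). Qed.

Let q (n : nat) : R := ratr (odflt 0 (unpickle n : option rat)).

Let ltq (x y : R) : x < y -> exists n, x < q n < y.
Proof.
move=> /rat_in_itvoo[r]; rewrite in_itv/= => xry.
by exists (pickle r); rewrite /q pickleK.
Qed.

(** The generalized inverse of [cdf] in its threshold, taken along an enumeration of the rationals:
    a countable infimum is measurable and meets only countably many exceptional null sets. *)
Let quantile (z : S * measurableTypeR R) : \bar R :=
  einfs (fun n => if z.2 < cdf (q n) z.1 then (q n)%:E else +oo%E) 0%N.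

Let mquantile : measurable_fun [set: S * measurableTypeR R] quantile.
Proof.
apply: (measurable_fun_einfs (f := fun n (z : S * measurableTypeR R) =>
  if z.2 < cdf (q n) z.1 then (q n)%:E else +oo%E)) => n.
apply: measurable_fun_ifT => //.
by apply: measurable_fun_ltr => //; exact: (measurableT_comp (mcdf (q n))).
Qed.

Let quantile_lt z (x : R) : (quantile z < x%:E)%E <->
  exists2 n, q n < x & z.2 < cdf (q n) z.1.
Proof.
split.
  move=> /ereal_inf_ltP[y [n _ <-]]; case: ifP => // zn; rewrite lte_fin => qx.
  by exists n.
move=> [n qx zn]; apply/ereal_inf_ltP; exists (q n)%:E; rewrite ?lte_fin//.
by exists n => //=; rewrite zn.
Qed.

Let cdf_ltE (A : set S) x : measurable A ->
  (P \x unif)%E [set z | A (W z.1) /\ z.2 < cdf x (W z.1)] =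
  P (W @^-1` A `&` lt_event x).
Proof.
move=> mA; have mWA := measurable_preim mW mA.
have := product_ltE P mWA (measurableT_comp (mcdf x) mW) (fun w => cdf01 x (W w)).
rewrite -/(preimage _ _) => ->.
have [_ _ ->//] := cdfP x; rewrite integral_indic//; by rewrite setIC.
Qed.

(** The versions at two thresholds are chosen separately, so monotonicity survives only almost
    everywhere. *)
Let cdf_mono x y : x <= y -> {ae P, forall w, cdf x (W w) <= cdf y (W w)}.
Proof.
move=> xy; have [mx ix xE] := cdfP x; have [my iy yE] := cdfP y.
apply: (ae_le_of_integral mW mx my ix iy) => B mB; have mWB := measurable_preim mW mB.
rewrite xE// yE// !integral_indic//; apply: le_measure; rewrite ?inE.
- exact: measurableI.
- exact: measurableI.
- by apply: setSI => w /= /lt_le_trans; apply.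
Qed.

Let quantile_law (A : set S) x : measurable A ->
  (P \x unif)%E [set z | A (W z.1) /\ (quantile (W z.1, z.2) < x%:E)%E] =
  P (W @^-1` A `&` lt_event x).
Proof.
move=> mA; have mWA := measurable_preim mW mA.
have mpair : measurable_fun [set: T * measurableTypeR R] (fun z => (W z.1, z.2)).
  by apply: measurable_fun_pair => //; exact: measurableT_comp.
have mAq (f : S * measurableTypeR R -> bool) :
    measurable_fun [set: S * measurableTypeR R] f ->
    measurable [set z : T * measurableTypeR R | A (W z.1) /\ f (W z.1, z.2)].
  move=> mf; apply: (@measurableI _ _ (fst @^-1` (W @^-1` A))
    [set z | f (W z.1, z.2)]); first exact: measurable_preim.
  by apply: measurable_pred; exact: (measurableT_comp mf mpair).
have mcdflt y : measurable_fun [set: S * measurableTypeR R]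
    (fun z => z.2 < cdf y z.1).
  by apply: measurable_fun_ltr => //; exact: (measurableT_comp (mcdf y)).
have mqlt : measurable_fun [set: S * measurableTypeR R] (fun z => quantile z < x%:E)%E.
  exact: measurable_fun_lte.
apply/eqP; rewrite eq_le; apply/andP; split.
(* Off one null set Z, common to all rationals below x, a rational witnessing [quantile < x] forces
   u < [cdf x]. *)
- have [Z [mZ PZ0 Zsub]] : {ae P, forall w n, q n < x -> cdf (q n) (W w) <= cdf x (W w)}.
    apply/ae_foralln => n; case: (ltP (q n) x) => [/ltW/cdf_mono|_]; last exact: nearW.
    by apply: filterS.
  have mZ' : measurable (fst @^-1` Z : set (T * measurableTypeR R)).
    exact: measurable_preim.
  have Z0 : (P \x unif)%E (fst @^-1` Z) = 0%E by rewrite product_fst.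
  rewrite -(cdf_ltE x mA).
  apply: (@le_trans _ _ ((P \x unif)%E ([set z | A (W z.1) /\ z.2 < cdf x (W z.1)]
    `|` fst @^-1` Z))).
    apply: le_measure; rewrite ?inE.
    + exact: (mAq (fun z => quantile z < x%:E)%E).
    + by apply: measurableU => //; exact: (mAq (fun z => z.2 < cdf x z.1)).
    + move=> [w u] /= [Aw /quantile_lt[n qx /= un]].
      have [Zw|nZw] := pselect (Z w); [by right|left; split=> //].
      apply: (lt_le_trans un); apply: contrapT => h; apply: nZw; apply: Zsub.
      by move=> /(_ n qx).
  apply: (le_trans (measureU2 _ _ _)) => //.
    exact: (mAq (fun z => z.2 < cdf x z.1)).
  by rewrite [X in (_ + X <= _)%E]Z0 adde0.
(* Conversely, [lt_event x] is defined by a strict inequality, hence is the increasing union of the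
   events at x - 1/(n+1). A rational strictly between x - 1/(n+1) and x dominates the n-th of
   them. *)
- pose F n := W @^-1` A `&` lt_event (x - n.+1%:R^-1).
  have mF n : measurable (F n) by apply: measurableI.
  have -> : W @^-1` A `&` lt_event x = \bigcup_n F n.
    rewrite /F -setI_bigcupr; congr (_ `&` _).
    apply/seteqP; split=> w /=.
      rewrite /lt_event/= -subr_gt0 => /ltr_add_invr[n]; rewrite add0r => nX.
      by exists n => //=; rewrite ltrBrDl -ltrBrDr.
    by move=> [n _] /= /lt_trans; apply; rewrite ltrBlDr ltrDl invr_gt0.
  have ndF : nondecreasing_seq F.
    move=> m n mn; apply/subsetPset; apply: setIS => w /= /lt_le_trans; apply.
    by rewrite lerD2l lerN2 lef_pV2 ?posrE// ler_nat.
  have cv := @nondecreasing_cvg_mu _ _ _ P _ mF (bigcup_measurable (fun i _ => mF i)) ndF.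
  rewrite -(cvg_lim _ cv)//; apply: lime_le; first by apply/cvg_ex; eexists; exact: cv.
  apply: nearW => n.
  have [m /andP[mx1 mx2]] : exists m, x - n.+1%:R^-1 < q m < x.
    by apply: ltq; rewrite ltrBlDr ltrDl invr_gt0.
  apply: (@le_trans _ _ (P (W @^-1` A `&` lt_event (q m)))).
    apply: le_measure; rewrite ?inE; [exact: mF|exact: measurableI|].
    by apply: setIS => w /= /lt_trans; apply.
  rewrite -(cdf_ltE (q m) mA); apply: le_measure; rewrite ?inE.
  + exact: (mAq (fun z => z.2 < cdf (q m) z.1)).
  + exact: (mAq (fun z => quantile z < x%:E)%E).
  + by move=> [w u] /= [Aw um]; split=> //; apply/quantile_lt; exists m.
Qed.

Lemma outsource_real : exists2 G : S * measurableTypeR R -> R,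
  measurable_fun [set: S * measurableTypeR R] G &
  same_law P (fun w => (W w, X w))
    (P \x unif)%E (fun z => (W z.1, G (W z.1, z.2))).
Proof.
exists (fine \o quantile); first exact: measurableT_comp.
have mpair : measurable_fun [set: T * measurableTypeR R] (fun z => (W z.1, z.2)).
  by apply: measurable_fun_pair => //; exact: measurableT_comp.
(* The laws are compared in the extended reals, where [quantile] takes its values and open lower
   rays form a generating pi-system; [fine] then brings the result back to R. *)
have XQ : same_law P (fun w => (W w, (X w)%:E)) (P \x unif)%E
    (fun z => (W z.1, quantile (W z.1, z.2))).
  apply: (@same_law_pair _ _ _ _ _ _ _ _ W (EFin \o X) _ _ _
    (fun z => W z.1) (fun z => quantile (W z.1, z.2)) _ _ _ _ _ (ErealGenInftyO.measurableE R)).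
  - exact: mW.
  - exact: measurableT_comp.
  - exact/measurable_EFinP.
  - exact: measurableT_comp mquantile mpair.
  - move=> _ _ [x ->] [y ->]; exists (Num.min x y).
    by apply/seteqP; split=> z /=; rewrite !in_itv/= EFin_min lt_min;
      [case=> -> ->|move/andP].
  - move=> B mB; rewrite -[RHS]/((P \x unif)%E (fst @^-1` (W @^-1` B))) product_fst//.
    exact: measurable_preim.
  - move=> A _ mA [x ->].
    have E1 : (fun z : T * measurableTypeR R => W z.1) @^-1` A `&`
        (fun z => quantile (W z.1, z.2)) @^-1` `]-oo, x%:E[ =
        [set z | A (W z.1) /\ (quantile (W z.1, z.2) < x%:E)%E].
      by apply/seteqP; split=> z /=; rewrite in_itv.
    have E2 : W @^-1` A `&` (EFin \o X) @^-1` `]-oo, x%:E[ = W @^-1` A `&` lt_event x.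
      by apply/seteqP; split=> z /=; rewrite /lt_event/= in_itv/= lte_fin.
    by rewrite E2 -(quantile_law x mA) -E1.
have mf : measurable_fun [set: S * \bar R] (fun y => (y.1, fine y.2)).
  by apply: measurable_fun_pair => //; exact: measurableT_comp.
move=> B mB; exact: (same_law_comp mf XQ mB).
Qed.

End outsourced_real.

Lemma outsourced_real (R : realType) : outsourced (@unif R) (measurableTypeR R).
Proof. by move=> d T P ds S W X mW mX; exact: outsource_real. Qed.

Section outsourced_closure.
Context {R : realType}.
Local Open Scope ereal_scope.

(** The image of X under i is what gets drawn; r undoes i, so pulling the draw back along r recovers
    the law of X. *)
Lemma outsourced_retract dx (Xi : measurableType dx) (K : probability Xi R)
    d1 (S1 : measurableType d1) d2 (S2 : measurableType d2)
    (i : S2 -> S1) (r : S1 -> S2) :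
  measurable_fun [set: S2] i -> measurable_fun [set: S1] r -> cancel i r ->
  outsourced K S1 -> outsourced K S2.
Proof.
move=> mi mr ir oS1 d T P ds S W X mW mX.
have [G mG GE] := oS1 _ _ P _ _ W (i \o X) mW (measurableT_comp mi mX).
exists (r \o G); first exact: measurableT_comp.
have mf : measurable_fun [set: S * S1] (fun z => (z.1, r z.2)).
  by apply: measurable_fun_pair => //; exact: measurableT_comp.
move=> B mB; rewrite -[RHS](same_law_comp mf GE mB); congr (P _).
by apply/seteqP; split=> w /=; rewrite ir.
Qed.

(** Chain rule for sampling: the first component is drawn given W, then the second given W and the
    first, each with a noise of its own. *)
Lemma outsourced_prod d1 (Xi1 : measurableType d1) (K1 : probability Xi1 R)
    d2 (Xi2 : measurableType d2) (K2 : probability Xi2 R)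
    d1' (S1 : measurableType d1') d2' (S2 : measurableType d2') :
  outsourced K1 S1 -> outsourced K2 S2 -> outsourced (K1 \x K2) (S1 * S2)%type.
Proof.
move=> o1 o2 d T P ds S W X mW mX.
have mX1 : measurable_fun [set: T] (fun w => (X w).1) by exact: measurableT_comp.
have mX2 : measurable_fun [set: T] (fun w => (X w).2) by exact: measurableT_comp.
have mWX1 := measurable_fun_pair mW mX1.
have [G1 mG1 G1E] := o1 _ _ P _ _ _ _ mW mX1.
have [G2 mG2 G2E] := o2 _ _ P _ _ _ _ mWX1 mX2.
pose h (z : (S * S1) * Xi2) := (z.1.1, (z.1.2, G2 z)).
have mh : measurable_fun [set: (S * S1) * Xi2] h.
  apply: measurable_fun_pair; first exact: measurableT_comp.
  by apply: measurable_fun_pair => //; exact: measurableT_comp.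
have m11 : measurable_fun [set: S * (Xi1 * Xi2)] (fun z => (z.1, z.2.1)).
  by apply: measurable_fun_pair => //; exact: measurableT_comp.
exists (fun z => (G1 (z.1, z.2.1), G2 ((z.1, G1 (z.1, z.2.1)), z.2.2))).
  apply: measurable_fun_pair; first exact: measurableT_comp.
  apply: (measurableT_comp mG2); apply: measurable_fun_pair.
    by apply: measurable_fun_pair => //; exact: measurableT_comp.
  exact: measurableT_comp.
have mWG1 : measurable_fun [set: T * Xi1] (fun z => (W z.1, G1 (W z.1, z.2))).
  have mW1 : measurable_fun [set: T * Xi1] (fun z => W z.1) by exact: measurableT_comp.
  apply: measurable_fun_pair => //; apply: (measurableT_comp mG1).
  exact: measurable_fun_pair.
pose a (z : (S * S1) * S2) := (z.1.1, (z.1.2, z.2)).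
have ma : measurable_fun [set: (S * S1) * S2] a.
  apply: measurable_fun_pair; first exact: measurableT_comp.
  by apply: measurable_fun_pair => //; exact: measurableT_comp.
move=> B mB.
have E1 := same_law_comp ma G2E mB.
have E2 := same_law_comp mh (same_law_product K2 mWX1 mWG1 G1E) mB.
have mG : measurable ((fun z : T * (Xi1 * Xi2) => (W z.1, (G1 (W z.1, z.2.1),
    G2 ((W z.1, G1 (W z.1, z.2.1)), z.2.2)))) @^-1` B).
  apply: measurable_preim mB.
  have mW1 : measurable_fun [set: T * (Xi1 * Xi2)] (fun z => W z.1) by exact: measurableT_comp.
  have mWx : measurable_fun [set: T * (Xi1 * Xi2)] (fun z => (W z.1, z.2.1)).
    by apply: measurable_fun_pair => //; exact: measurableT_comp.
  have mG1x : measurable_fun [set: T * (Xi1 * Xi2)] (fun z => G1 (W z.1, z.2.1)).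
    exact: measurableT_comp.
  apply: measurable_fun_pair => //; apply: measurable_fun_pair => //.
  apply: (measurableT_comp mG2); apply: measurable_fun_pair.
    exact: measurable_fun_pair.
  exact: measurableT_comp.
have E3 := @product_assoc _ _ _ P _ _ K1 _ _ K2 _ mG.
rewrite -[RHS]E3 -[RHS]E2 -[RHS]E1; congr (P _).
by apply/seteqP; split=> w /=; rewrite /a/= -surjective_pairing.
Qed.

End outsourced_closure.

Section outsourced_finite.
Context {R : realType} {A : finPointedType}.

Let code (a : discrete A) : R := (enum_rank (a : A))%:R.

(** A left inverse of [code], equal to [point] off its range; as a chain of tests on x it is
    measurable. *)
Let decode (x : R) : discrete A :=
  foldr (fun a b : A => if x == code a then a else b) point (enum A).

Let codeK : cancel code decode.
Proof.
move=> a; rewrite /decode.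
have : (a : A) \in enum A by rewrite mem_enum.
elim: (enum A) => //= b s ih; rewrite inE => /orP[/eqP <-|/ih]; first by rewrite eqxx.
case: ifPn => // /eqP; rewrite /code => /eqP.
by rewrite eqr_nat => /eqP/val_inj/enum_rank_inj.
Qed.

Lemma outsourced_discrete : outsourced (@unif R) (discrete A).
Proof.
apply: (outsourced_retract (i := code) (r := decode)) (@outsourced_real R) => //.
rewrite /decode; elim: (enum A) => [|a s ih] /=; first exact: measurable_cst.
by apply: measurable_fun_ifT => //; exact: measurable_fun_eqr.
Qed.

End outsourced_finite.

Section tuple_noise.
Variable R : realType.

Fixpoint tnoise_display (n : nat) : measure_display :=
  if n is n'.+1
  then measure_prod_display (R.-ocitv.-measurable.-sigma, tnoise_display n')%mdisp
  else R.-ocitv.-measurable.-sigma%mdisp.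

(** One uniform variable per coordinate of an n-tuple, and a last one for the real u_t that
    accompanies the covariates. *)
Fixpoint tnoise (n : nat) : measurableType (tnoise_display n) :=
  if n is n'.+1 return measurableType (tnoise_display n)
  then (measurableTypeR R * tnoise n')%type else measurableTypeR R.

Fixpoint tnoise_law (n : nat) : probability (tnoise n) R :=
  if n is n'.+1 return probability (tnoise n) R
  then (unif \x tnoise_law n')%E else unif.

Lemma outsourced_tuple (n : nat) :
  outsourced (tnoise_law n) (n.-tuple (measurableTypeR R) * measurableTypeR R)%type.
Proof.
elim: n => [|n ih] /=.
  apply: (outsourced_retract (i := snd) (r := fun x => ([tuple], x))) (@outsourced_real R) => //.
    by apply: measurable_fun_pair => //; exact: measurable_cst.
  by move=> [t x]; rewrite (tuple0 t).
have := outsourced_prod (@outsourced_real R) ih.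
apply: (outsourced_retract
  (i := fun z : n.+1.-tuple (measurableTypeR R) * measurableTypeR R =>
          (thead z.1, ([tuple of behead z.1], z.2)))
  (r := fun z => ([tuple of z.1 :: z.2.1], z.2.2))).
- apply: measurable_fun_pair.
    by apply: (measurableT_comp (measurable_tnth ord0)).
  apply: measurable_fun_pair => //.
  by apply: (measurableT_comp (@measurable_behead _ _ n)).
- apply: measurable_fun_pair; last exact: measurableT_comp.
  by apply: measurable_cons => //; exact: measurableT_comp.
- by move=> [t x]; rewrite /= -tuple_eta.
Qed.

End tuple_noise.

(** * Redrawing one noise variable *)

Section noise.
Context {R : realType} (dd : nat -> measure_display)
  (F : forall i, measurableType (dd i)) (K : forall i, probability (F i) R).

Fixpoint noise_display (n : nat) : measure_display :=
  if n is n'.+1 then measure_prod_display (noise_display n', dd n')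
  else default_measure_display.

Fixpoint noise (n : nat) : measurableType (noise_display n) :=
  if n is n'.+1 return measurableType (noise_display n)
  then (noise n' * F n')%type else unit.

Fixpoint noise_law (n : nat) : probability (noise n) R :=
  if n is n'.+1 return probability (noise n) R
  then (noise_law n' \x K n')%E else dirac tt.

(* [point] is returned out of range. *)
Fixpoint ncoord (n : nat) : noise n -> forall i, F i :=
  if n is n'.+1 return noise n -> forall i, F i
  then fun w => @dfwith _ (fun i => F i : Type) (ncoord w.1) n' w.2
  else fun _ _ => point.

Fixpoint of_coord (n : nat) (e : forall i, F i) : noise n :=
  if n is n'.+1 return noise n then (of_coord n' e, e n') else tt.

(** Independence is handled through this map: a variable that ignores coordinate i is one that
    [resample] leaves unchanged, and [resample_law] makes the replacement invisible in law. *)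
Definition resample n i (z : noise n * F i) : noise n :=
  of_coord n (@dfwith _ (fun i => F i : Type) (ncoord z.1) i z.2).

Lemma ncoord_of_coord n (e : forall i, F i) i : (i < n)%N -> ncoord (of_coord n e) i = e i.
Proof.
elim: n => //= n ih; rewrite ltnS leq_eqVlt => /orP[/eqP->|lin].
  by rewrite dfwithin.
by rewrite dfwithout ?ih// gtn_eqF.
Qed.

Lemma eq_of_coord n (e e' : forall i, F i) :
  (forall i, (i < n)%N -> e i = e' i) -> of_coord n e = of_coord n e'.
Proof.
elim: n => //= n ih ee'; rewrite ee'//; congr (_, _).
by apply: ih => i /ltnW; exact: ee'.
Qed.

Lemma of_coordK n (w : noise n) : of_coord n (ncoord w) = w.
Proof.
elim: n w => [[]|n ih] //= [w x] /=; rewrite dfwithin; congr (_, _).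
rewrite -[RHS]ih; apply: eq_of_coord => i lin.
by rewrite dfwithout// gtn_eqF.
Qed.

Lemma ncoord_resample n i (z : noise n * F i) j : (j < n)%N ->
  ncoord (resample z) j = @dfwith _ (fun i => F i : Type) (ncoord z.1) i z.2 j.
Proof. exact: ncoord_of_coord. Qed.

Lemma measurable_ncoord n i : measurable_fun [set: noise n] (fun w => ncoord w i).
Proof.
elim: n => [|n ih] //=; have [<-|ni] := eqVneq n i.
  rewrite (_ : (fun w => _) = snd) //; apply/funext => w.
  by rewrite dfwithin.
rewrite (_ : (fun w => _) = (fun w => ncoord w i) \o fst).
  exact: measurableT_comp.
by apply/funext => w /=; rewrite dfwithout.
Qed.

Lemma measurable_of_coord d (T : measurableType d) n (e : T -> forall i, F i) :
  (forall i, measurable_fun [set: T] (fun w => e w i)) ->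
  measurable_fun [set: T] (fun w => of_coord n (e w)).
Proof.
by move=> me; elim: n => //= n ih; exact: measurable_fun_pair.
Qed.

Lemma measurable_resample n i : measurable_fun [set: noise n * F i] (@resample n i).
Proof.
apply: measurable_of_coord => j; have [<-|ij] := eqVneq i j.
  rewrite (_ : (fun w => _) = snd) //; apply/funext => w.
  by rewrite dfwithin.
rewrite (_ : (fun w => _) = (fun w => ncoord w j) \o fst).
  by apply: measurableT_comp => //; exact: measurable_ncoord.
by apply/funext => w /=; rewrite dfwithout.
Qed.

Let resample_last n (z : noise n * F n * F n) :
  @resample n.+1 n z = (z.1.1, z.2).
Proof.
case: z => -[w x] y; rewrite /resample/= !dfwithin; congr (_, _).
rewrite -[RHS]of_coordK; apply: eq_of_coord => j jn.
by rewrite !dfwithout// gtn_eqF.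
Qed.

Let resample_init n i (z : noise n * F n * F i) : (i < n)%N ->
  @resample n.+1 i z = (resample (z.1.1, z.2), z.1.2).
Proof.
case: z => -[w x] y lin; rewrite /resample/=; congr (_, _); last first.
  by rewrite dfwithout ?dfwithin// ltn_eqF.
apply: eq_of_coord => j jn; have [<-|ij] := eqVneq i j; first by rewrite !dfwithin.
by rewrite !dfwithout// gtn_eqF.
Qed.

(** Induction on n. If i is the last coordinate, the old value is integrated out; otherwise the
    fresh value is moved past the last coordinate and the induction hypothesis applies to the
    others. *)
Lemma resample_law n i : (i < n)%N ->
  same_law (noise_law n \x K i)%E (@resample n i) (noise_law n) id.
Proof.
elim: n => // n ih; rewrite ltnS leq_eqVlt => /orP[/eqP->|lin] B mB.
  rewrite (_ : @resample n.+1 n = (fun z => (z.1.1, z.2))); last first.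
    by apply/funext => z; exact: resample_last.
  exact: (same_law_product (K n) (@measurable_fst _ _ _ _) (@measurable_id _ _ setT)
    (@product_fst _ _ _ _ _ (noise_law n) (K n)) mB).
rewrite (_ : @resample n.+1 i = (fun z => (resample z.1, z.2)) \o
    (fun z => ((z.1.1, z.2), z.1.2))); last first.
  by apply/funext => z; exact: resample_init.
have mr : measurable_fun [set: (noise n * F i) * F n] (fun z => (resample z.1, z.2)).
  by apply: measurable_fun_pair => //; apply: measurableT_comp => //; exact: measurable_resample.
have E1 := @product_swapA _ _ _ (noise_law n) _ _ (K n) _ _ (K i) _ (measurable_preim mr mB).
rewrite [LHS]E1.
exact: (same_law_product (K n) (@measurable_resample n i) (@measurable_id _ _ setT) (ih lin) mB).
Qed.

End noise.

Section redraw.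
Context {R : realType}.
Local Open Scope ereal_scope.
Context d1 (T1 : measurableType d1) (P1 : probability T1 R)
  d2 (T2 : measurableType d2) (P2 : probability T2 R)
  d3 (T3 : measurableType d3) (P3 : probability T3 R).

Lemma product_snd B : measurable B -> (P2 \x P3) (snd @^-1` B) = P3 B.
Proof.
move=> mB; rewrite -setTX product_measure1E//.
by rewrite [X in X * _]probability_setT mul1e.
Qed.

(** Both laws integrate the section probabilities [h] over independent x and y: the discarded
    coordinate has total mass one. *)
Lemma product_redraw :
  same_law ((P1 \x (P2 \x P3)) \x P2) (fun z => (z.1.1, (z.2, z.1.2.2)))
    (P1 \x (P2 \x P3)) id.
Proof.
move=> B mB.
have m12 : measurable_fun [set: (T1 * (T2 * T3)) * T2] (fun z => (z.1.1, (z.2, z.1.2.2))).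
  apply: measurable_fun_pair; first exact: measurableT_comp.
  apply: measurable_fun_pair => //.
  by apply: (measurableT_comp measurable_snd); exact: measurableT_comp.
pose h (z : T1 * T2) := P3 [set y | B (z.1, (z.2, y))].
have mh : measurable_fun [set: T1 * T2] h.
  apply: (@measurable_prob_section1 _ _ _ _ _ P3 [set u | B (u.1.1, (u.1.2, u.2))]).
  apply: measurable_preim mB.
  apply: measurable_fun_pair; first exact: measurableT_comp.
  by apply: measurable_fun_pair => //; exact: measurableT_comp.
have h0 z : 0 <= h z by [].
rewrite [LHS](product2E _ _ (measurable_preim m12 mB)) [RHS]product1E/=.
transitivity (\int[P1]_x \int[P2]_y h (x, y)); last first.
  by apply: eq_integral => x _; rewrite [RHS]product1E.
rewrite (fubini_tonelli _ mh h0); apply: eq_integral => x _.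
rewrite [LHS]product1E; apply: eq_integral => w _.
rewrite -[LHS]/((P2 \x P3) (snd @^-1` [set y | B (w, (x, y))])) product_snd//.
exact: (measurable_section1 x (measurable_section1 w mB)).
Qed.

End redraw.

Section resample_fst.
Context {R : realType} (d1 d2 : nat -> measure_display)
  (F1 : forall i, measurableType (d1 i)) (F2 : forall i, measurableType (d2 i))
  (K1 : forall i, probability (F1 i) R) (K2 : forall i, probability (F2 i) R).

Let F i := (F1 i * F2 i)%type : measurableType _.
Let K i : probability (F i) R := (K1 i \x K2 i)%E.

(** The treatment noise and the covariate noise of time i form a single coordinate, and
    exchangeability requires redrawing the former while keeping the latter. *)
Definition resample1 n i (z : noise F n * F1 i) : noise F n :=
  resample (z.1, (z.2, (ncoord z.1 i).2)).

Lemma measurable_resample1 n i : measurable_fun [set: noise F n * F1 i] (@resample1 n i).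
Proof.
apply: (measurableT_comp (@measurable_resample _ F n i)).
apply: measurable_fun_pair => //; apply: measurable_fun_pair => //.
apply: (measurableT_comp measurable_snd).
by apply: (measurableT_comp (@measurable_ncoord _ F n i)).
Qed.

Lemma resample1_law n i : (i < n)%N ->
  same_law (noise_law K n \x K1 i)%E (@resample1 n i) (noise_law K n) id.
Proof.
move=> lin B mB; have rl := @resample_law R _ F K n i lin.
have mr := @measurable_resample _ F n i; have mr1 := @measurable_resample1 n i.
(* The whole pair at i may be redrawn beforehand without changing the law. Redrawing its first
   component a second time is then harmless by [product_redraw]. *)
have E1 := same_law_product (K1 i) mr (@measurable_id _ _ setT) rl.
have {}E1 := same_law_comp mr1 E1 mB.
rewrite -[LHS]E1 -[RHS](rl _ mB).
have E2 := @product_redraw _ _ _ (noise_law K n) _ _ (K1 i) _ _ (K2 i).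
rewrite -[RHS](E2 _ (measurable_preim mr mB)).
congr (((noise_law K n \x K i)%E \x K1 i)%E _); apply/seteqP.
suff E z : @resample1 n i (@resample _ F n i z.1, z.2) =
    @resample _ F n i (z.1.1, (z.2, z.1.2.2)).
  by split=> z /=; rewrite E.
case: z => -[w [y xi]] x; apply: eq_of_coord => j jn /=.
have [<-|ij] := eqVneq i j; last by rewrite !dfwithout// ncoord_resample//= dfwithout.
by rewrite !dfwithin ncoord_resample//= dfwithin.
Qed.

End resample_fst.

(** * Treatment sequences and the backward recursion *)

Section tseq.
Variable A : nat -> finPointedType.

(* [point] is returned out of range. *)
Fixpoint tseq_nth (n : nat) : tseq A n -> forall i, trt_type A i :=
  if n is n'.+1 return tseq A n -> forall i, trt_type A i
  then fun s => @dfwith _ (trt_type A) (tseq_nth s.1) n' s.2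
  else fun _ _ => point.

Lemma tseq_nth_last n (s : tseq A n.+1) : tseq_nth s n = s.2.
Proof. by rewrite /= dfwithin. Qed.

Lemma tseq_nth_init n (s : tseq A n.+1) i : (i < n)%N -> tseq_nth s i = tseq_nth s.1 i.
Proof. by move=> lin; rewrite /= dfwithout// gtn_eqF. Qed.

Lemma eq_tseq n (s s' : tseq A n) :
  (forall i, (i < n)%N -> tseq_nth s i = tseq_nth s' i) -> s = s'.
Proof.
elim: n s s' => [[] []|n ih] //= [s a] [s' a'] /= ss'; congr (_, _).
  by apply: ih => i lin; have := ss' i (ltnW lin); rewrite !dfwithout// gtn_eqF.
by have := ss' n (ltnSn n); rewrite !dfwithin.
Qed.

Lemma finite_tseq n : finite_set [set: tseq A n].
Proof.
elim: n => [|n ih] /=; first exact: finite_finset.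
by rewrite -setXTT; apply: finite_setX => //; exact: finite_finset.
Qed.

Context {R : realType} d (T : measurableType d) (P : probability T R).

Lemma ae_forall_tseq n (Q : tseq A n -> T -> Prop) :
  (forall s, {ae P, forall w, Q s w}) -> {ae P, forall w s, Q s w}.
Proof.
elim: n Q => [|n ih] Q QP; first by apply: filterS (QP tt) => w Qw [].
have {}QP : {ae P, forall w s a, Q (s, a) w}.
  apply: (ih (fun s w => forall a, Q (s, a) w)) => s; apply: filter_forall => a.
  exact: QP.
by apply: filterS QP => w Qw [s a].
Qed.

Variables (R' : realType) (k : nat -> nat).

Fixpoint hist_tseq (n : nat) : hist R' A k n -> tseq A n :=
  if n is n'.+1 return hist R' A k n -> tseq A n
  then fun h => (hist_tseq h.1.1, h.1.2) else fun=> tt.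

Definition const_rule n (s : tseq A n) : rule R' A k := fun t _ => tseq_nth s t.

Lemma const_rule_rules n (s : tseq A n) : rules (const_rule s).
Proof. by move=> t; exact: measurable_cst. Qed.

(** Positivity is assumed rule by rule. Since each history follows the constant rule that repeats
    its own treatments, constant rules suffice to reach all histories. *)
Lemma follows_const_rule n (h : hist R' A k n) :
  follows (const_rule (hist_tseq h)) h.
Proof.
suff aux (r : rule R' A k) :
  (forall i h', (i < n)%N -> r i h' = tseq_nth (hist_tseq h) i) -> follows r h.
  by apply: aux.
elim: n h => //= n ih [[h a] l] /= dE; split.
  by apply: ih => i h' lin; apply: (etrans (dE _ _ (ltnW lin))); exact: (@tseq_nth_init n (_, _)).
by apply/esym/(etrans (dE n _ (ltnSn n))); exact: (@tseq_nth_last n (_, _)).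
Qed.

End tseq.

(** * The maximum and the truncated sum as aggregators *)

Section aggregators.
Context {R : realType} {A : nat -> finPointedType}.

Definition measurable_agg (agg : forall t, (trt_type A t -> R) -> R) :=
  forall t d (T : measurableType d) (f : trt_type A t -> T -> R),
    (forall a, measurable_fun [set: T] (f a)) ->
    measurable_fun [set: T] (fun w => agg t (f^~ w)).

Definition agg01 (agg : forall t, (trt_type A t -> R) -> R) :=
  forall t (f : trt_type A t -> R), (forall a, 0 <= f a <= 1) -> 0 <= agg t f <= 1.

Lemma agg_maxP t (f : trt_type A t -> R) x :
  (x < agg_max f) <-> exists a, x < f a.
Proof.
rewrite /agg_max; split=> [|[a xa]].
  case: (boolP [exists a, x < f a]) => [/existsP|/existsPn xf]; first by [].
  rewrite ltNge => /negP; case; apply/bigmax_leP; split => [|a _];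
    by rewrite leNgt xf.
exact: (lt_le_trans xa (le_bigmax _ _ _)).
Qed.

Lemma measurable_agg_max : measurable_agg (@agg_max R A).
Proof.
move=> t d T f mf; rewrite /agg_max unlock /= /reducebig.
elim: (index_enum _) => [|a s ih] /=; first exact: mf.
exact: measurable_maxr.
Qed.

Lemma agg_max01 : agg01 (@agg_max R A).
Proof.
move=> t f f01; apply/andP; split.
  case/andP: (f01 point) => f0 _; apply: (le_trans f0); exact: bigmax_ge_id.
have f1 a : f a <= 1 by case/andP: (f01 a).
by apply/bigmax_leP; split.
Qed.

Lemma measurable_agg_sum : measurable_agg (@agg_sum R A).
Proof.
move=> t d T f mf; apply: measurable_minr => //.
exact: measurable_sum.
Qed.

Lemma agg_sum01 : agg01 (@agg_sum R A).
Proof.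
move=> t f f01; rewrite /agg_sum le_min ler01/= ge_min lexx/= andbT.
by apply: sumr_ge0 => a _; case/andP: (f01 a).
Qed.

End aggregators.

(** * The backward recursion with regressions valued in [0, 1] *)

Section regressions.
Context {R : realType} {A : nat -> finPointedType} {k : nat -> nat}.
Context d0 (T : measurableType d0) (P : probability T R).
Variables (X : process R A k T) (N : nat).
Hypothesis mcov : forall t, (t <= N)%N -> measurable_fun [set: T] (cov X t).
Hypothesis mtrt : forall t, (t <= N)%N -> measurable_fun [set: T] (trt X t).
Hypothesis mout : measurable_fun [set: T] (out X).

Lemma measurable_H t : (t <= N)%N -> measurable_fun [set: T] (H X t).
Proof.
elim: t => [|t ih] tN; first exact: mcov.
apply: measurable_fun_pair; last exact: mcov.
by apply: measurable_fun_pair; [exact/ih/ltnW|exact/mtrt/ltnW].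
Qed.

Lemma measurable_HA t : (t <= N)%N -> measurable_fun [set: T] (HA X t).
Proof. by move=> tN; apply: measurable_fun_pair; [exact: measurable_H|exact: mtrt]. Qed.

Lemma measurable_trt_eq t a : (t <= N)%N -> measurable (trt X t @^-1` [set a]).
Proof. by move=> tN; apply: measurable_preim => //; exact: mtrt. Qed.

Definition propensity t (a : trt_type A t) : hist R A k t -> R :=
  clamp \o cprob P (H X t) (trt X t @^-1` [set a]).

Lemma propensity01 t (a : trt_type A t) h : 0 <= propensity a h <= 1.
Proof. by rewrite clamp_ge0 clamp_le1. Qed.

Lemma propensityP t (a : trt_type A t) : (t <= N)%N ->
  is_cexp P (H X t) \1_(trt X t @^-1` [set a]) (propensity a).
Proof.
move=> tN; have mE := measurable_trt_eq a tN.
apply: (is_cexp_clamp (measurable_H tN) _ _ (cprobP P (measurable_H tN) mE)) => [|w].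
  exact: measurable_indic.
by rewrite indicE ler0n lern1 leq_b1.
Qed.

Hypothesis pos : seq_positivity P X N.

(** There are finitely many treatment sequences of length t, so the null sets of their constant
    rules can be joined. *)
Lemma propensity_gt0 t (a : trt_type A t) : (t <= N)%N ->
  {ae P, forall w, 0 < propensity a (H X t w)}.
Proof.
move=> tN.
have : {ae P, forall w (s : tseq A t), follows (const_rule s) (H X t w) ->
    0 < cprob P (H X t) (trt X t @^-1` [set a]) (H X t w)}.
  by apply: ae_forall_tseq => s; apply: pos => //; exact: const_rule_rules.
apply: filterS => w /(_ _ (follows_const_rule _)) p0.
by rewrite /propensity/= /clamp lt_max lt_min ltr01 p0 orbT.
Qed.

(** The propensity of a integrates over the bad histories to the probability that A_t = a at a bad
    history, which is 0. As the propensity is positive almost everywhere, the bad histories are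
    null. This turns statements about the observed treatment into statements about every
    treatment. *)
Lemma ae_HA t (C : set (hist R A k t * trt_type A t)) (a : trt_type A t) :
  (t <= N)%N -> measurable C -> {ae P, forall w, C (HA X t w)} ->
  {ae P, forall w, C (H X t w, a)}.
Proof.
move=> tN mC aeC.
pose B := [set h | ~ C (h, a)].
have mB : measurable B.
  by rewrite (_ : B = ~` [set h | C (h, a)])//; apply/measurableC/measurable_section2.
have mHB := measurable_preim (measurable_H tN) mB.
have mE := measurable_trt_eq a tN.
have [mp ip pE] := propensityP a tN.
have := pE B mB.
have -> : (\int[P]_(w in H X t @^-1` B) (\1_(trt X t @^-1` [set a]) w)%:E = 0)%E.
  rewrite integral_indic//; apply/eqP; rewrite eq_le measure_ge0 andbT.
  case: aeC => Z [mZ <- Zsub]; apply: le_measure; rewrite ?inE//.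
    exact: measurableI.
  by move=> w [/= aw Bw]; apply: Zsub => /= Cw; apply: Bw; rewrite -aw.
rewrite [X in X = _](_ : _ = \int[P]_(w in H X t @^-1` B)
  `|(propensity a (H X t w))%:E|)%E; last first.
  by apply: eq_integral => w _; rewrite gee0_abs// lee_fin clamp_ge0.
move/(ae_eq_integral_abs P mHB) => h.
have /h : measurable_fun (H X t @^-1` B) (fun w => (propensity a (H X t w))%:E).
  by apply: measurable_funTS; exact: measurable_int ip.
apply: filterS2 (propensity_gt0 a tN) => w p0 hw.
by apply: contrapT => /hw [] p00; rewrite p00 ltxx in p0.
Qed.

Variable agg : forall t, (trt_type A t -> R) -> R.
Hypothesis magg : measurable_agg agg.
Hypothesis agg_01 : agg01 agg.

Definition qclamp (j t : nat) : hist R A k t * trt_type A t -> R :=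
  fun z => clamp (qfun P X agg j z).

Definition vclamp (j t : nat) (h : hist R A k t) : R :=
  agg (fun a => qclamp j (h, a)).

Lemma qclamp01 j t z : 0 <= @qclamp j t z <= 1.
Proof. by rewrite clamp_ge0 clamp_le1. Qed.

Lemma vclamp01 j t h : 0 <= @vclamp j t h <= 1.
Proof. by apply: agg_01 => a; exact: qclamp01. Qed.

(** The variable regressed on (H_t, A_t), built from clamped regressions; [raw_target] is its
    counterpart in the definition of [qfun]. *)
Definition target (j t : nat) (w : T) : R :=
  if j is j'.+1 then vclamp j' (H X t.+1 w) else (out X w)%:R.

Lemma target01 j t w : 0 <= target j t w <= 1.
Proof.
case: j => [|j]; last exact: vclamp01.
by rewrite /target ler0n lern1 leq_b1.
Qed.

Let measurable_vclamp j t :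
  measurable_fun [set: hist R A k t * trt_type A t] (@qclamp j t) ->
  measurable_fun [set: hist R A k t] (@vclamp j t).
Proof.
move=> mq; apply: magg => a.
exact: (measurableT_comp mq (pair2_measurable a)).
Qed.

Let measurable_out : measurable_fun [set: T] (fun w => (out X w)%:R : R).
Proof.
rewrite (_ : (fun w => _) = (fun w => if out X w then 1 else 0)).
  exact: measurable_fun_ifT.
by apply/funext => w; case: (out X w).
Qed.

Let raw_target (j t : nat) (w : T) : R :=
  if j is j'.+1 then agg (fun a : trt_type A t.+1 => qfun P X agg j' (H X t.+1 w, a))
  else (out X w)%:R.

Let qfunE j t : qfun P X agg j (t := t) = cexp P (HA X t) (raw_target j t).
Proof. by case: j. Qed.

(** The two targets agree almost everywhere, so [qfun] is also a version of the regression of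
    [target]. It thus lies in [0, 1] almost everywhere along (H_t, A_t), and by [ae_HA] also along
    (H_t, a) for each a. *)
Let qclamp_step j t : (t <= N)%N -> measurable_fun [set: T] (target j t) ->
  measurable_fun [set: T] (raw_target j t) ->
  {ae P, forall w, target j t w = raw_target j t w} ->
  [/\ measurable_fun [set: hist R A k t * trt_type A t] (qfun P X agg j (t := t)),
      is_cexp P (HA X t) (target j t) (@qclamp j t) &
      forall a, {ae P, forall w, @qclamp j t (H X t w, a) = qfun P X agg j (H X t w, a)}].
Proof.
move=> tN mt mr aetr; have mHA := measurable_HA tN.
have ir : P.-integrable [set: T] (fun w => (raw_target j t w)%:E).
  have it := integrable01 P measurableT mt (target01 j t).
  apply/integrableP; split; first exact/measurable_EFinP.
  have /integrableP[_] := it.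
  rewrite (_ : (\int[P]_w _)%E = (\int[P]_w `|(raw_target j t w)%:E|)%E)//.
  apply: ae_eq_integral => //; [|by apply: measurableT_comp => //; exact/measurable_EFinP|].
    by apply: measurableT_comp => //; exact/measurable_EFinP.
  by apply: filterS aetr => w /= ->.
have cq : is_cexp P (HA X t) (target j t) (qfun P X agg j (t := t)).
  rewrite qfunE; apply: (is_cexp_ae_eqX mHA (cexpP mHA ir) mr mt).
  by apply: filterS aetr => w ->.
have mq : measurable_fun [set: hist R A k t * trt_type A t] (qfun P X agg j (t := t)).
  by case: cq.
split=> //; first exact: (is_cexp_clamp mHA mt (target01 j t) cq).
move=> a; have q01 := is_cexp_ae01 mHA mt (target01 j t) cq.
have mC : measurable [set z : hist R A k t * trt_type A t | 0 <= qfun P X agg j z <= 1].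
  by apply: measurable_pred; apply: measurable_and; exact: measurable_fun_ler.
by apply: filterS (ae_HA a tN mC q01) => w /= qw; rewrite /qclamp clamp_id.
Qed.

Lemma qclampP j t : (t + j)%N = N ->
  [/\ measurable_fun [set: T] (target j t),
      measurable_fun [set: hist R A k t * trt_type A t] (qfun P X agg j (t := t)),
      is_cexp P (HA X t) (target j t) (@qclamp j t) &
      forall a, {ae P, forall w, @qclamp j t (H X t w, a) = qfun P X agg j (H X t w, a)}].
Proof.
move=> tjN.
(* The induction also carries the measurability of [raw_target]: with it comes integrability,
   without which [cexpP] says nothing about [cexp]. *)
suff [? ? [? ? ?]] : [/\ measurable_fun [set: T] (target j t),
      measurable_fun [set: T] (raw_target j t) &
   [/\ measurable_fun [set: hist R A k t * trt_type A t] (qfun P X agg j (t := t)),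
      is_cexp P (HA X t) (target j t) (@qclamp j t) &
      forall a, {ae P, forall w, @qclamp j t (H X t w, a) = qfun P X agg j (H X t w, a)}]].
  by split.
elim: j t tjN => [|j ih] t tjN; have tN : (t <= N)%N by rewrite -tjN leq_addr.
  by split=> //; apply: qclamp_step => //; exact: nearW.
have t1N : (t.+1 <= N)%N by rewrite -tjN addnS ltnS leq_addr.
have [_ _ [mq [mqc _ _] qE]] := ih t.+1 (etrans (addSnnS t j) tjN).
have mH := measurable_H t1N.
have mt : measurable_fun [set: T] (target j.+1 t).
  exact: measurableT_comp (measurable_vclamp mqc) mH.
have mr : measurable_fun [set: T] (raw_target j.+1 t).
  apply: (@magg t.+1 _ _ (fun a w => qfun P X agg j (H X t.+1 w, a))) => a.
  apply: (measurableT_comp mq); exact: (measurable_fun_pair mH (measurable_cst a)).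
split=> //; apply: qclamp_step => //.
have : {ae P, forall w a, @qclamp j t.+1 (H X t.+1 w, a) = qfun P X agg j (H X t.+1 w, a)}.
  exact: filter_forall.
by apply: filterS => w qw /=; congr (agg _); apply/funext => a; exact: qw.
Qed.

Lemma measurable_qclamp j t : (t + j)%N = N ->
  measurable_fun [set: hist R A k t * trt_type A t] (@qclamp j t).
Proof. by move=> /qclampP[_ _ [? _ _] _]. Qed.

Lemma measurable_vclampP j t : (t + j)%N = N ->
  measurable_fun [set: hist R A k t] (@vclamp j t).
Proof. by move=> tjN; exact: (measurable_vclamp (measurable_qclamp tjN)). Qed.

Lemma valueE : value P X N agg = (\int[P]_w (vclamp N (H X 0 w))%:E)%E.
Proof.
rewrite /value unlock.
have mv := measurable_vclampP (add0n N).
have [_ mq _ qE] := qclampP (add0n N).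
have {}qE : {ae P, forall w a, @qclamp N 0 (H X 0 w, a) = qfun P X agg N (H X 0 w, a)}.
  exact: filter_forall.
have mH := measurable_H (leq0n N).
apply: ae_eq_integral => //.
- apply/measurable_EFinP; apply: (@magg 0 _ _ (fun a w => qfun P X agg N (H X 0 w, a))) => a.
  apply: (measurableT_comp mq); exact: (measurable_fun_pair mH (measurable_cst a)).
- by apply/measurable_EFinP; exact: (measurableT_comp mv mH).
- apply: filterS qE => w qw _ /=; congr (agg _)%:E.
  by apply/funext => a; rewrite qw.
Qed.

End regressions.

(** * The coordinate process on the data space *)

Section data.
Context {R : realType} {A : nat -> finPointedType} {k : nat -> nat}.

Lemma measurable_hist_cov n t :
  measurable_fun [set: hist R A k n] (fun h => hist_cov h t).
Proof.
elim: n => [|n ih] /=.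
  have [<-|nt] := eqVneq 0%N t.
    rewrite (_ : (fun h => _) = id); first exact: measurable_id.
    by apply/funext => h; rewrite dfwithin.
  rewrite (_ : (fun h => _) = fun=> point); first exact: measurable_cst.
  by apply/funext => h; rewrite dfwithout.
have [<-|nt] := eqVneq n.+1 t.
  rewrite (_ : (fun w => _) = snd) //; apply/funext => w.
  by rewrite dfwithin.
rewrite (_ : (fun w => _) = (fun h => hist_cov h t) \o (fst \o fst)).
  by apply: measurableT_comp => //; exact: measurableT_comp.
by apply/funext => w /=; rewrite dfwithout.
Qed.

Lemma measurable_hist_trt n t :
  measurable_fun [set: hist R A k n] (fun h => hist_trt h t).
Proof.
elim: n => [|n ih] /=; first exact: measurable_cst.
have [<-|nt] := eqVneq n t.
  rewrite (_ : (fun w => _) = snd \o fst); first exact: measurableT_comp.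
  by apply/funext => w; rewrite dfwithin.
rewrite (_ : (fun w => _) = (fun h => hist_trt h t) \o (fst \o fst)).
  by apply: measurableT_comp => //; exact: measurableT_comp.
by apply/funext => w /=; rewrite dfwithout.
Qed.

Lemma measurable_data_cov N t :
  measurable_fun [set: data R A k N] (cov (data_process R A k N) t).
Proof.
apply: (measurableT_comp (@measurable_hist_cov N t)); exact: measurableT_comp.
Qed.

Lemma measurable_data_trt N t :
  measurable_fun [set: data R A k N] (trt (data_process R A k N) t).
Proof.
rewrite /=; have [<-|nt] := eqVneq N t.
  rewrite (_ : (fun w => _) = snd \o fst); first exact: measurableT_comp.
  by apply/funext => w; rewrite dfwithin.
rewrite (_ : (fun w => _) = (fun h => hist_trt h t) \o (fst \o fst)).
  by apply: (measurableT_comp (@measurable_hist_trt N t)); exact: measurableT_comp.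
by apply/funext => w /=; rewrite dfwithout.
Qed.

Lemma measurable_data_out N :
  measurable_fun [set: data R A k N] (out (data_process R A k N)).
Proof. exact: measurable_snd. Qed.

Lemma eq_H T T' (X : process R A k T) (X' : process R A k T') w w' t :
  (forall i, (i <= t)%N -> cov X i w = cov X' i w') ->
  (forall i, (i < t)%N -> trt X i w = trt X' i w') -> H X t w = H X' t w'.
Proof.
elim: t => [|t ih] covE trtE /=; first exact: covE.
rewrite covE// trtE//; congr (_, _, _).
by apply: ih => i it; [apply: covE; exact: leq_trans it _|apply: trtE; exact: ltnW].
Qed.

Section observed.
Context T (X : process R A k T).

Lemma hist_cov_H n t w : (t <= n)%N -> hist_cov (H X n w) t = cov X t w.
Proof.
elim: n => [|n ih]; first by rewrite leqn0 => /eqP -> /=; rewrite dfwithin.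
rewrite leq_eqVlt => /orP[/eqP ->|tn] /=; first by rewrite dfwithin.
by rewrite dfwithout ?ih// gtn_eqF.
Qed.

Lemma hist_trt_H n t w : (t < n)%N -> hist_trt (H X n w) t = trt X t w.
Proof.
elim: n => // n ih; rewrite ltnS leq_eqVlt => /orP[/eqP ->|tn] /=.
  by rewrite dfwithin.
by rewrite dfwithout ?ih// gtn_eqF.
Qed.

Definition observe N (w : T) : data R A k N := (H X N w, trt X N w, out X w).

Lemma data_trt_observe N t w : (t <= N)%N ->
  trt (data_process R A k N) t (observe N w) = trt X t w.
Proof.
rewrite leq_eqVlt => /orP[/eqP ->|tn] /=; first by rewrite dfwithin.
by rewrite dfwithout ?hist_trt_H// gtn_eqF.
Qed.

Lemma data_H_observe N t w : (t <= N)%N ->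
  H (data_process R A k N) t (observe N w) = H X t w.
Proof.
move=> tN; apply: eq_H => i it; first by rewrite /= hist_cov_H// (leq_trans it).
by rewrite data_trt_observe// ltnW// (leq_trans it).
Qed.

End observed.

Lemma observe_data N (x : data R A k N) : observe (data_process R A k N) N x = x.
Proof.
case: x => -[h a] y; rewrite /observe /= dfwithin; congr (_, _, _).
suff aux n (h' : hist R A k n) T (X : process R A k T) w :
    (forall i, (i <= n)%N -> cov X i w = hist_cov h' i) ->
    (forall i, (i < n)%N -> trt X i w = hist_trt h' i) -> H X n w = h'.
  by apply: aux => i iN //=; rewrite dfwithout// gtn_eqF.
elim: n h' => [|n ih] h' covE trtE /=; first by rewrite covE//= dfwithin.
case: h' covE trtE => -[h' b] l covE trtE.
rewrite covE// trtE//= !dfwithin; congr (_, _, _); apply: ih => i lin.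
  by rewrite covE ?(leq_trans lin)//= dfwithout// gtn_eqF.
by rewrite trtE ?(leq_trans lin)//= dfwithout// gtn_eqF.
Qed.

End data.

(** * Moving regressions from P to a sample space carrying it *)

Section transfer.
Context {R : realType} {d0 d1} {S0 : measurableType d0} {T : measurableType d1}.
Variables (P : probability S0 R) (Q : probability T R) (phi : T -> S0).
Hypothesis mphi : measurable_fun [set: T] phi.
Hypothesis QP : forall B, measurable B -> Q (phi @^-1` B) = P B.

Lemma integral_transfer (D : set S0) (g : S0 -> R) : measurable D ->
  measurable_fun [set: S0] g -> (forall x, 0 <= g x <= 1) ->
  (\int[Q]_(w in phi @^-1` D) (g (phi w))%:E = \int[P]_(x in D) (g x)%:E)%E.
Proof.
move=> mD mg g01.
rewrite -[LHS](@ge0_integral_pushforward _ _ _ _ _ _ mphi Q D (EFin \o g))//.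
- by apply: eq_measure_integral => B mB _; exact: QP.
- by apply: measurable_funTS; exact/measurable_EFinP.
- by move=> x _; rewrite lee_fin; case/andP: (g01 x).
Qed.

Lemma ae_transfer (C : S0 -> Prop) :
  {ae P, forall x, C x} -> {ae Q, forall w, C (phi w)}.
Proof.
case=> Z [mZ PZ0 Zsub]; exists (phi @^-1` Z); split.
- exact: measurable_preim.
- by rewrite QP.
- by move=> w /= nC; exact: Zsub.
Qed.

(** The function f is kept, so the regressions computed once under P serve for every compatible
    law. *)
Lemma is_cexp_transfer d2 (S : measurableType d2) (W : S0 -> S) (X : S0 -> R)
    (f : S -> R) :
  measurable_fun [set: S0] W -> measurable_fun [set: S0] X ->
  (forall x, 0 <= X x <= 1) -> (forall s, 0 <= f s <= 1) ->
  is_cexp P W X f -> is_cexp Q (W \o phi) (X \o phi) f.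
Proof.
move=> mW mX X01 f01 [mf _ fE]; split=> //.
  apply: (integrable01 _ measurableT) => //.
  exact: (measurableT_comp mf (measurableT_comp mW mphi)).
move=> B mB; have mWB := measurable_preim mW mB.
have E1 := integral_transfer mWB (measurableT_comp mf mW) (fun x => f01 (W x)).
have E2 := integral_transfer mWB mX X01.
by rewrite [LHS]E1 [RHS]E2 fE.
Qed.

End transfer.

(** * Validity of the bounds *)

Section splice.
Context {R : realType} {A : nat -> finPointedType} {k : nat -> nat} {N : nat}.

Lemma measurable_discrete_index (B : finPointedType) d (T : measurableType d)
    d' (S : measurableType d') (f : discrete B -> T -> S) (tau : T -> discrete B) :
  (forall b, measurable_fun [set: T] (f b)) -> measurable_fun [set: T] tau ->
  measurable_fun [set: T] (fun w => f (tau w) w).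
Proof.
move=> mf mtau _ Y mY; rewrite setTI.
rewrite (_ : _ @^-1` Y = \bigcup_(b in [set: discrete B])
    (tau @^-1` [set b] `&` f b @^-1` Y)).
  apply: fin_bigcup_measurable; first exact: finite_finset.
  move=> b _; apply: measurableI; last exact: measurable_preim.
  exact: measurable_preim.
apply/seteqP; split=> w /=; first by move=> Yw; exists (tau w).
by move=> [b _ [/= ->]].
Qed.

Context d (T : measurableType d).
Variable M : cf_process R A k N T.
Hypothesis mM : measurable_process M.

Let mcov t : (t <= N)%N -> measurable_fun [set: T] (cov M t).
Proof. by case: mM => + _ _ _ _; apply. Qed.

Let mtrt t : (t <= N)%N -> measurable_fun [set: T] (trt M t).
Proof. by case: mM => _ + _ _ _; apply. Qed.

Let mcf_cov t (s : tseq A t.+1) : (t < N)%N -> measurable_fun [set: T] (cf_cov M s).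
Proof. by case: mM => _ _ _ + _ tN; apply. Qed.

Let mcf_out s : measurable_fun [set: T] (cf_out M s).
Proof. by case: mM. Qed.

(** The sequence depends on w, but each observed treatment has finitely many values, so it can be
    frozen one coordinate at a time. *)
Lemma measurable_splice t n d' (S : measurableType d') (f : tseq A n -> T -> S)
    (s : tseq A n) : (n <= N.+1)%N ->
  (forall s, measurable_fun [set: T] (f s)) ->
  measurable_fun [set: T] (fun w => f (splice M t w s) w).
Proof.
elim: n f s => [|n ih] f s nN mf /=; first exact: mf.
apply: (ih (fun s1 w => f (s1, if (n < t)%N then trt M n w else s.2) w)); first exact: ltnW.
move=> s1; case: (ltnP n t) => _; last exact: mf.
apply: (@measurable_discrete_index _ _ _ _ _ (fun b w => f (s1, b) w)); last exact: mtrt.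
by move=> b; exact: mf.
Qed.

Lemma measurable_cf_hist n (s : tseq A n) : (n <= N)%N ->
  measurable_fun [set: T] (cf_hist M s).
Proof.
elim: n s => [|n ih] s nN /=; first exact: mcov.
apply: measurable_fun_pair; last exact: mcf_cov.
by apply: measurable_fun_pair; [exact/ih/ltnW|exact: measurable_cst].
Qed.

Lemma measurable_future_events t : future_events M t `<=` measurable.
Proof.
move=> E [[n [s [B [/andP[tn nN] mB ->]]]]|[s [b ->]]].
  apply: (@measurable_preim _ _ _ _ (fun w => cf_hist M (splice M t w s) w)) => //.
  apply: (@measurable_splice t n.+1 _ _ (fun s w => cf_hist M s w)) => [|s'].
    exact: ltnW.
  exact: measurable_cf_hist.
apply: (@measurable_preim _ _ _ _ (fun w => cf_out M (splice M t w s) w) [set b]) => //.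
exact: (@measurable_splice t N.+1 _ _ (fun s w => cf_out M s w)).
Qed.

Lemma measurable_sigma_future_events t : <<s future_events M t >> `<=` measurable.
Proof.
apply: smallest_sub; last exact: measurable_future_events.
exact: sigma_algebra_measurable.
Qed.

Lemma tseq_nth_splice t n w (s : tseq A n) i : (i < n)%N ->
  tseq_nth (splice M t w s) i = if (i < t)%N then trt M i w else tseq_nth s i.
Proof.
elim: n s => // n ih s; rewrite ltnS leq_eqVlt => /orP[/eqP ->|lin].
  by rewrite !tseq_nth_last.
by rewrite !tseq_nth_init//= ih.
Qed.

Lemma tseq_nth_obs_seq n w i : (i < n)%N -> tseq_nth (obs_seq M n w) i = trt M i w.
Proof.
elim: n => // n ih; rewrite ltnS leq_eqVlt => /orP[/eqP ->|lin].
  by rewrite tseq_nth_last.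
by rewrite tseq_nth_init//= ih.
Qed.

Lemma splice0 n w (s : tseq A n) : splice M 0 w s = s.
Proof. by apply: eq_tseq => i lin; rewrite tseq_nth_splice. Qed.

Lemma splice_all n w (s : tseq A n) : splice M n w s = obs_seq M n w.
Proof. by apply: eq_tseq => i lin; rewrite tseq_nth_splice// tseq_nth_obs_seq// lin. Qed.

(* The events W_t and W_t^a. *)
Definition attainable t : set T := [set w | exists s, cf_out M (splice M t w s) w].

Definition attainable_via t (a : trt_type A t) : set T :=
  [set w | exists2 s : tseq A N.+1, tseq_nth s t = a & cf_out M (splice M t w s) w].

Lemma attainable_bigcup t w : attainable t w <-> exists a, attainable_via (t := t) a w.
Proof.
split=> [[s sw]|[a [s _ sw]]]; last by exists s.
by exists (tseq_nth s t); exists s.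
Qed.

Lemma attainable_via_observed t a w : (t <= N)%N -> trt M t w = a ->
  attainable_via a w <-> attainable t.+1 w.
Proof.
move=> tN ta; split=> [[s sa sw]|[s sw]].
  exists s; rewrite (_ : splice _ _ _ _ = splice M t w s)//.
  apply: eq_tseq => i iN; rewrite !tseq_nth_splice// ltnS leq_eqVlt.
  by have [->|//] := eqVneq i t; rewrite ltnn ta sa.
exists (splice M t.+1 w s); first by rewrite tseq_nth_splice// ltnSn.
rewrite (_ : splice _ _ _ _ = splice M t.+1 w s)//.
apply: eq_tseq => i iN; rewrite !tseq_nth_splice//.
by case: (ltnP i t) => // it; rewrite ltnS (ltnW it).
Qed.

Lemma attainable0 w : attainable 0 w <-> exists s, cf_out M s w.
Proof. by split=> -[s sw]; exists s; move: sw; rewrite splice0. Qed.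

(** At time [N.+1] every treatment has been replaced by the observed one, which leaves a single
    sequence, the one to which consistency applies. *)
Lemma attainable_end w : seq_consistency M -> attainable N.+1 w <-> out M w.
Proof.
move=> [_ co]; rewrite (co _ _ (erefl (obs_seq M N.+1 w))).
split=> [[s]|sw]; first by rewrite splice_all.
by exists (obs_seq M N.+1 w); rewrite splice_all.
Qed.

(** A finite union of generating events, hence an event to which exchangeability applies. *)
Lemma sigma_attainable_via t a : <<s future_events M t >> (attainable_via (t := t) a).
Proof.
rewrite (_ : attainable_via a = \bigcup_(s in [set s : tseq A N.+1 | tseq_nth s t = a])
    [set w | cf_out M (splice M t w s) w = true]); last first.
  by apply/seteqP; split=> w [s /= sa sw]; exists s.
apply: (@fin_bigcup_measurable _ (g_sigma_algebraType (future_events M t))).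
  exact: sub_finite_set (finite_tseq _ _).
by move=> s _; apply: sub_sigma_algebra; right; exists s, true.
Qed.

Lemma measurable_attainable_via t a : measurable (attainable_via (t := t) a).
Proof. exact: measurable_sigma_future_events (sigma_attainable_via a). Qed.

Lemma measurable_attainable t : measurable (attainable t).
Proof.
rewrite (_ : attainable t = \bigcup_(a in [set: trt_type A t]) attainable_via a).
  apply: fin_bigcup_measurable; first exact: finite_finset.
  by move=> a _; exact: measurable_attainable_via.
apply/seteqP; split=> w; first by move=> /attainable_bigcup[a aw]; exists a.
by move=> [a _ aw]; apply/attainable_bigcup; exists a.
Qed.

Lemma rule_seq_const_rule (s : tseq A N.+1) w : rule_seq M (const_rule s) N.+1 w = s.
Proof.
suff aux n i : (i < n)%N ->
    tseq_nth (rule_seq M (const_rule s) n w) i = tseq_nth s i.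
  by apply: eq_tseq => i iN; exact: aux.
elim: n => // n ih; rewrite ltnS leq_eqVlt => /orP[/eqP ->|lin].
  by rewrite tseq_nth_last.
by rewrite tseq_nth_init//= ih.
Qed.

Lemma V_perfectE (Q : probability T R) : V_perfect Q M = Q (attainable 0).
Proof.
rewrite /V_perfect unlock.
transitivity (\int[Q]_w (\1_(attainable 0) w)%:E)%E; last first.
  by rewrite integral_indic ?setIT//; exact: measurable_attainable.
apply: eq_integral => w _ /=; congr (_%:E); rewrite indicE.
set E := [set _ | _ in _].
have E0 d0 : rules d0 -> E (Yd M d0 w)%:R by exists d0.
(* This rule keeps the set of outcomes inhabited when no sequence succeeds, so that it equals
   {0}. *)
have r0 : rules (const_rule (A := A) (R' := R) (k := k) (n := 0) tt).
  exact: const_rule_rules.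
have ubE : ubound E 1 by move=> _ [d0 _ <-]; rewrite lern1 leq_b1.
have [/set_mem/attainable0[s sw]|/negP nw] := boolP (w \in attainable 0).
  have E1 : E 1.
    by have := E0 _ (const_rule_rules s); rewrite /Yd rule_seq_const_rule sw.
  apply/eqP; rewrite eq_le sup_le_ub//=; last by exists 1.
  by apply: ub_le_sup => //; exists 1.
rewrite (_ : E = [set 0]) ?sup1//; apply/seteqP; split=> x.
  move=> [d0 _ <-] /=; case: (boolP (Yd M d0 w)) => // Yw.
  by case: nw; apply/mem_set/attainable0; exists (rule_seq M d0 N.+1 w).
move=> ->; have := E0 _ r0; case: (boolP (Yd _ _ w)) => // Yw.
by case: nw; apply/mem_set/attainable0; eexists; exact: Yw.
Qed.

End splice.

Section bounds.
Context {R : realType} {A : nat -> finPointedType} {k : nat -> nat} {N : nat}.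

(* The lower and upper bounds have the same proof, up to the direction [b] of
   the inequality. *)
Definition cmp (b : bool) d (T : porderType d) (x y : T) : bool :=
  if b then (x <= y)%O else (y <= x)%O.

(** To be read at a history, with x the probability [w_] of W_t, g the probabilities [e_] of the
    W_t^a and f the values of q_t: the conditions on x are those satisfied by the probability of a
    union. *)
Definition sandwich (b : bool) (agg : forall t, (trt_type A t -> R) -> R) :=
  forall t (f g : trt_type A t -> R) (x : R), (forall a, g a <= x) ->
    x <= \sum_a g a -> x <= 1 -> (forall a, cmp b (f a) (g a)) ->
    cmp b (agg t f) x.

Lemma sandwich_max : sandwich true (@agg_max R A).
Proof.
move=> t f g x gx _ _ fg; apply/bigmax_leP.
by split=> [|a _]; exact: le_trans (fg _) (gx _).
Qed.

Lemma sandwich_sum : sandwich false (@agg_sum R A).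
Proof.
move=> t f g x _ xg x1 fg; rewrite /cmp /agg_sum le_min x1 (le_trans xg)//.
by apply: ler_sum => a _; exact: fg.
Qed.

Context d (T : measurableType d) (Q : probability T R) (M : cf_process R A k N T).
Variable P : probability (data R A k N) R.
Hypothesis comp : compatible Q M P.
Hypothesis pos : seq_positivity P (data_process R A k N) N.
Variable agg : forall t, (trt_type A t -> R) -> R.
Hypothesis magg : measurable_agg agg.
Hypothesis agg_01 : agg01 agg.
Variable b : bool.
Hypothesis sagg : sandwich b agg.

Notation D := (data_process R A k N).
Let mM : measurable_process M. Proof. by case: comp. Qed.

Let mcov t : (t <= N)%N -> measurable_fun [set: T] (cov M t).
Proof. by case: mM => + _ _ _ _; apply. Qed.

Let mtrt t : (t <= N)%N -> measurable_fun [set: T] (trt M t).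
Proof. by case: mM => _ + _ _ _; apply. Qed.

Let mout : measurable_fun [set: T] (out M).
Proof. by case: mM. Qed.

Let mphi : measurable_fun [set: T] (observe M N).
Proof.
apply: measurable_fun_pair => //; apply: measurable_fun_pair; last exact: mtrt.
exact: measurable_H mcov mtrt _ _.
Qed.

Let QP B : measurable B -> Q (observe M N @^-1` B) = P B.
Proof. by case: comp => _ + _ _; apply. Qed.

Let mdcov t (_ : (t <= N)%N) := @measurable_data_cov R A k N t.
Let mdtrt t (_ : (t <= N)%N) := @measurable_data_trt R A k N t.
Let mdout := @measurable_data_out R A k N.

Let mH t (tN : (t <= N)%N) := measurable_H mcov mtrt tN.
Let mHA t (tN : (t <= N)%N) := measurable_HA mcov mtrt tN.

Notation q := (qclamp P D agg).
Notation v := (vclamp P D agg).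
Notation p := (propensity P D).

Let lt_of_add t j : (t + j.+1)%N = N -> (t.+1 <= N)%N.
Proof. by move=> <-; rewrite addnS ltnS leq_addr. Qed.

Let H_observe t : (t <= N)%N -> H D t \o observe M N = H M t.
Proof. by move=> tN; apply/funext => w; exact: data_H_observe. Qed.

Let HA_observe t : (t <= N)%N -> HA D t \o observe M N = HA M t.
Proof.
by move=> tN; apply/funext => w; congr (_, _);
  [exact: data_H_observe|exact: data_trt_observe].
Qed.

Let trt_event_observe t (a : trt_type A t) : (t <= N)%N ->
  \1_(trt D t @^-1` [set a]) \o observe M N = \1_(trt M t @^-1` [set a]) :> (T -> R).
Proof.
move=> tN; apply/funext => w; have E := data_trt_observe M w tN.
rewrite -[LHS]/(\1_(_ @^-1` _) (observe M N w)) !indicE; congr (nat_of_bool _)%:R.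
apply/idP/idP => /set_mem h; apply/mem_set; first exact: etrans (esym E) h.
exact: etrans E h.
Qed.

Let pP t (a : trt_type A t) : (t <= N)%N ->
  is_cexp Q (H M t) \1_(trt M t @^-1` [set a]) (p a).
Proof.
move=> tN; have mE := measurable_trt_eq mdtrt a tN.
have := is_cexp_transfer mphi QP (measurable_H mdcov mdtrt tN) (measurable_indic mE)
  _ (propensity01 P D a) (propensityP P mdcov mdtrt a tN).
rewrite H_observe// trt_event_observe//; apply => w.
by rewrite indicE ler0n lern1 leq_b1.
Qed.

Let p_gt0 t (a : trt_type A t) : (t <= N)%N -> {ae Q, forall w, 0 < p a (H M t w)}.
Proof.
move=> tN; have := ae_transfer mphi QP (propensity_gt0 pos a tN).
by apply: filterS => w; rewrite data_H_observe.
Qed.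

Let mq j t (e : (t + j)%N = N) := measurable_qclamp mdcov mdtrt mdout pos magg agg_01 e.
Let mv j t (e : (t + j)%N = N) := measurable_vclampP mdcov mdtrt mdout pos magg agg_01 e.
Let q01 j t z : 0 <= @q j t z <= 1 := qclamp01 P D agg j z.
Let v01 j t h : 0 <= @v j t h <= 1 := vclamp01 P D agg_01 j h.

Let qP j t : (t + j)%N = N ->
  is_cexp Q (HA M t)
    (if j is j'.+1 then fun w => v j' (H M t.+1 w) else fun w => (out M w)%:R)
    (@q j t).
Proof.
move=> e; have tN : (t <= N)%N by rewrite -e leq_addr.
have [mt _ cq _] := qclampP mdcov mdtrt mdout pos magg agg_01 e.
have := is_cexp_transfer mphi QP (measurable_HA mdcov mdtrt tN) mt
  (target01 P D agg_01 j t) (@q01 j t) cq.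
rewrite HA_observe//; congr is_cexp; apply/funext => w.
case: j e {mt cq} => [//|j] e; congr (vclamp _ _ _ _ _).
exact/data_H_observe/lt_of_add/e.
Qed.

Let e_ t (a : trt_type A t) : hist R A k t -> R :=
  clamp \o cprob Q (H M t) (attainable_via M a).

Let w_ t : hist R A k t -> R := clamp \o cprob Q (H M t) (attainable M t).

Let clamp_cprobP t E : (t <= N)%N -> measurable E ->
  is_cexp Q (H M t) \1_E (clamp \o cprob Q (H M t) E).
Proof.
move=> tN mE; apply: (is_cexp_clamp (mH tN) _ _ (cprobP Q (mH tN) mE)) => [|w].
  exact: measurable_indic.
by rewrite indicE ler0n lern1 leq_b1.
Qed.

Let clamp_cprob_ae t E : (t <= N)%N -> measurable E ->
  {ae Q, forall w, clamp (cprob Q (H M t) E (H M t w)) = cprob Q (H M t) E (H M t w)}.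
Proof.
move=> tN mE.
exact: (is_cexp_unique (mH tN) (clamp_cprobP tN mE) (cprobP Q (mH tN) mE)).
Qed.

Let e01 t a h : 0 <= @e_ t a h <= 1. Proof. by rewrite clamp_ge0 clamp_le1. Qed.
Let w01 t h : 0 <= @w_ t h <= 1. Proof. by rewrite clamp_ge0 clamp_le1. Qed.

(** Exchangeability enters here: it makes the product of propensity and [e_] the conditional
    probability of the joint event. *)
Let integral_pe t (a : trt_type A t) B : (t <= N)%N -> measurable B ->
  (\int[Q]_(w in H M t @^-1` B) (p a (H M t w) * e_ a (H M t w))%:E =
   Q ((trt M t @^-1` [set a] `&` attainable_via M a) `&` H M t @^-1` B))%E.
Proof.
move=> tN mB; have mE := measurable_trt_eq mtrt a tN.
have mV := measurable_attainable_via mM a.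
have mEV := measurableI _ _ mE mV.
have mHB := measurable_preim (mH tN) mB.
have [_ _ _ exch] := comp.
have {}exch := exch t tN [set a] _ _ (sigma_attainable_via (M := M) a).
have {}exch : {ae Q, forall w,
    cprob Q (H M t) (trt M t @^-1` [set a] `&` attainable_via M a) (H M t w) =
    cprob Q (H M t) (trt M t @^-1` [set a]) (H M t w) *
    cprob Q (H M t) (attainable_via M a) (H M t w)} by exact: exch.
have [mc ic cE] := cprobP Q (mH tN) mEV.
rewrite -integral_indic// -cE//.
have mpe : measurable_fun [set: T] (fun w => p a (H M t w) * e_ a (H M t w)).
  apply: measurable_funM.
    by apply: (measurableT_comp _ (mH tN)); case: (pP a tN).
  by apply: (measurableT_comp _ (mH tN)); case: (clamp_cprobP tN mV).
apply: ae_eq_integral => //.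
- exact/measurable_funTS/measurable_EFinP.
- by apply: measurable_funTS; exact: measurable_int ic.
have pE := is_cexp_unique (mH tN) (pP a tN) (cprobP Q (mH tN) mE).
have eE := clamp_cprob_ae tN mV.
by apply: filterS3 exch pE eE => w -> <- <-.
Qed.

(** Pulling out turns the weight p into the event A_t = a, on which q at (H_t, a) is q at (H_t,
    A_t). *)
Let integral_pq t j (a : trt_type A t) B : (t + j)%N = N -> measurable B ->
  (\int[Q]_(w in H M t @^-1` B) (p a (H M t w) * q j (H M t w, a))%:E =
   \int[Q]_(w in HA M t @^-1` (B `*` [set a])) (q j (HA M t w))%:E)%E.
Proof.
move=> e mB; have tN : (t <= N)%N by rewrite -e leq_addr.
have mE := measurable_trt_eq mtrt a tN.
have mqa : measurable_fun [set: hist R A k t] (fun h => q j (h, a)).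
  exact: (measurableT_comp (mq e) (pair2_measurable a)).
rewrite (is_cexp_pull_out (mH tN) mE (pP a tN) (propensity01 P D a) mqa)//.
rewrite [RHS](_ : _ = \int[Q]_(w in H M t @^-1` B `&` trt M t @^-1` [set a])
  (q j (HA M t w))%:E)%E; last by congr integral.
by apply: eq_integral => w /set_mem[_ /= <-].
Qed.

(** [S_] and [T_] are the two half-steps of the backward induction, before and after aggregating
    over treatments. The integrated form avoids conditional probabilities given (H_t, A_t). *)
Let S_ t j := forall C, measurable C ->
  cmp b (\int[Q]_(w in HA M t @^-1` C) (q j (HA M t w))%:E)%E
        (Q (attainable M t.+1 `&` HA M t @^-1` C)).

Let T_ t j := forall B, measurable B ->
  cmp b (\int[Q]_(w in H M t @^-1` B) (v j (H M t w))%:E)%E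
        (Q (attainable M t `&` H M t @^-1` B)).

Let cmp_ae_of_integral t (f g : hist R A k t -> R) : (t <= N)%N ->
  measurable_fun setT f -> measurable_fun setT g ->
  (forall h, 0 <= f h <= 1) -> (forall h, 0 <= g h <= 1) ->
  (forall B, measurable B ->
    cmp b (\int[Q]_(w in H M t @^-1` B) (f (H M t w))%:E)%E
          (\int[Q]_(w in H M t @^-1` B) (g (H M t w))%:E)%E) ->
  {ae Q, forall w, cmp b (f (H M t w)) (g (H M t w))}.
Proof.
move=> tN mf mg f01 g01 fg.
have mfH : measurable_fun [set: T] (f \o H M t) := measurableT_comp mf (mH tN).
have mgH : measurable_fun [set: T] (g \o H M t) := measurableT_comp mg (mH tN).
have intf := integrable01 Q measurableT mfH (fun w => f01 (H M t w)).
have intg := integrable01 Q measurableT mgH (fun w => g01 (H M t w)).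
by rewrite /cmp in fg *; case: b fg => fg; exact: (ae_le_of_integral (mH tN)).
Qed.

Let cmp_integral_of_ae t (f g : hist R A k t -> R) B : (t <= N)%N ->
  measurable B ->
  measurable_fun setT f -> measurable_fun setT g ->
  (forall h, 0 <= f h <= 1) -> (forall h, 0 <= g h <= 1) ->
  {ae Q, forall w, cmp b (f (H M t w)) (g (H M t w))} ->
  cmp b (\int[Q]_(w in H M t @^-1` B) (f (H M t w))%:E)%E
        (\int[Q]_(w in H M t @^-1` B) (g (H M t w))%:E)%E.
Proof.
move=> tN mB mf mg f01 g01 fg; have mHB := measurable_preim (mH tN) mB.
have mfH : measurable_fun [set: T] (f \o H M t) := measurableT_comp mf (mH tN).
have mgH : measurable_fun [set: T] (g \o H M t) := measurableT_comp mg (mH tN).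
have f0 h : 0 <= f h by case/andP: (f01 h).
have g0 h : 0 <= g h by case/andP: (g01 h).
by rewrite /cmp in fg *; case: b fg => fg; apply: ae_ge0_le_integral => //;
  do ?[by move=> x _; rewrite lee_fin]; do ?[exact/measurable_funTS/measurable_EFinP];
  apply: filterS fg => w fgw _; rewrite lee_fin.
Qed.

Let att_HA t a B : (t <= N)%N ->
  attainable M t.+1 `&` HA M t @^-1` (B `*` [set a]) =
  (trt M t @^-1` [set a] `&` attainable_via M a) `&` H M t @^-1` B.
Proof.
move=> tN; apply/seteqP; split=> w /=.
  by move=> [aw [Bw ta]]; split=> //; split=> //; apply/attainable_via_observed.
by move=> [[ta aw] Bw]; split; [apply/(attainable_via_observed (a := a))|].
Qed.

Let integral_w t B : (t <= N)%N -> measurable B ->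
  (\int[Q]_(w in H M t @^-1` B) (w_ (H M t w))%:E =
   Q (attainable M t `&` H M t @^-1` B))%E.
Proof.
move=> tN mB; have mHB := measurable_preim (mH tN) mB.
have mW := measurable_attainable mM t.
by have [_ _ ->//] := clamp_cprobP tN mW; rewrite integral_indic.
Qed.

Let integral_e t a B : (t <= N)%N -> measurable B ->
  (\int[Q]_(w in H M t @^-1` B) (@e_ t a (H M t w))%:E =
   Q (attainable_via M a `&` H M t @^-1` B))%E.
Proof.
move=> tN mB; have mHB := measurable_preim (mH tN) mB.
have mW := measurable_attainable_via mM a.
by have [_ _ ->//] := clamp_cprobP tN mW; rewrite integral_indic.
Qed.

Let me_ t a : (t <= N)%N -> measurable_fun setT (@e_ t a).
Proof. by move=> tN; case: (clamp_cprobP tN (measurable_attainable_via mM a)). Qed.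

Let mw_ t : (t <= N)%N -> measurable_fun setT (@w_ t).
Proof. by move=> tN; case: (clamp_cprobP tN (measurable_attainable mM t)). Qed.

Let int_e t a : (t <= N)%N -> Q.-integrable setT (fun w => (@e_ t a (H M t w))%:E).
Proof.
move=> tN; apply: (integrable01 Q measurableT _ (fun w => e01 a (H M t w))).
exact: (measurableT_comp (me_ a tN) (mH tN)).
Qed.

Let int_w t : (t <= N)%N -> Q.-integrable setT (fun w => (@w_ t (H M t w))%:E).
Proof.
move=> tN; apply: (integrable01 Q measurableT _ (fun w => w01 (H M t w))).
exact: (measurableT_comp (mw_ tN) (mH tN)).
Qed.

Let ae_qe t j a : (t + j)%N = N -> S_ t j ->
  {ae Q, forall w, cmp b (q j (H M t w, a)) (e_ a (H M t w))}.
Proof.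
move=> e St; have tN : (t <= N)%N by rewrite -e leq_addr.
have mqa : measurable_fun [set: hist R A k t] (fun h => q j (h, a)).
  exact: (measurableT_comp (mq e) (pair2_measurable a)).
have mp : measurable_fun [set: hist R A k t] (p a) by case: (pP a tN).
have m01 (x y : R) : 0 <= x <= 1 -> 0 <= y <= 1 -> 0 <= x * y <= 1.
  by move=> /andP[x0 x1] /andP[y0 y1]; rewrite mulr_ge0// mulr_ile1.
have h : {ae Q, forall w, cmp b (p a (H M t w) * q j (H M t w, a))
    (p a (H M t w) * e_ a (H M t w))}.
  apply: (@cmp_ae_of_integral t (fun h => p a h * q j (h, a)) (fun h => p a h * e_ a h)) => //.
  - exact: measurable_funM.
  - exact: measurable_funM (me_ a tN).
  - by move=> h; apply: m01; [exact: propensity01|exact: q01].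
  - by move=> h; apply: m01; [exact: propensity01|exact: e01].
  move=> B mB; rewrite integral_pe// integral_pq// -att_HA//.
  by apply: St; exact: measurableX.
(* Positivity allows the propensity to be cancelled. *)
by apply: filterS2 h (p_gt0 a tN) => w; rewrite /cmp; case: b => + p0;
  rewrite ler_pM2l.
Qed.

Let ae_ew t a : (t <= N)%N -> {ae Q, forall w, e_ a (H M t w) <= @w_ t (H M t w)}.
Proof.
move=> tN; apply: (ae_le_of_integral (mH tN) (me_ a tN) (mw_ tN) (int_e a tN) (int_w tN)).
move=> B mB; rewrite integral_e// integral_w//; have mHB := measurable_preim (mH tN) mB.
apply: le_measure; rewrite ?inE.
- by apply: measurableI => //; exact: measurable_attainable_via.
- by apply: measurableI => //; exact: measurable_attainable.
- by apply: setSI => w aw; apply/attainable_bigcup; exists a.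
Qed.

Let ae_wS t : (t <= N)%N -> {ae Q, forall w, @w_ t (H M t w) <= \sum_a e_ a (H M t w)}.
Proof.
move=> tN.
have mS : measurable_fun [set: hist R A k t] (fun h => \sum_a e_ a h).
  by apply: measurable_sum => a; exact: me_.
apply: (ae_le_of_integral (mH tN) (mw_ tN) mS (int_w tN)).
  rewrite (_ : (fun w => _) = (fun w => \sum_(a : trt_type A t) (e_ a (H M t w))%:E)%E).
    by apply: integrable_sum => // a _; exact: int_e.
  by apply/funext => w; rewrite sumEFin.
move=> B mB; have mHB := measurable_preim (mH tN) mB.
have mA a := measurable_attainable_via mM (t := t) a.
rewrite integral_w// -integral_indic//; last exact: measurable_attainable.
apply: (@le_trans _ _ (\int[Q]_(w in H M t @^-1` B)
    \sum_(a : trt_type A t) (\1_(attainable_via M a) w)%:E)%E).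
  apply: ge0_le_integral => //.
  - apply/measurable_funTS/measurable_EFinP/measurable_indic.
    exact: measurable_attainable.
  - apply: emeasurable_sum => a; apply/measurable_funTS/measurable_EFinP.
    exact: measurable_indic.
  - move=> w _; rewrite sumEFin lee_fin indicE.
    case: (boolP (w \in attainable M t)) => [/set_mem/attainable_bigcup[a aw]|_] /=.
      rewrite (bigD1 a)//= indicE mem_set//= lerDl.
      by apply: sumr_ge0.
    by apply: sumr_ge0.
rewrite ge0_integral_sum//; last first.
  by move=> a; apply/measurable_funTS/measurable_EFinP/measurable_indic.
rewrite [leRHS](_ : _ = \int[Q]_(w in H M t @^-1` B)
    \sum_(a : trt_type A t) (e_ a (H M t w))%:E)%E; last first.
  by apply: eq_integral => w _; rewrite sumEFin.
rewrite ge0_integral_sum//; last 2 first.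
- move=> a; apply/measurable_funTS/measurable_EFinP.
  exact: (measurableT_comp (me_ a tN) (mH tN)).
- by move=> a w _; rewrite lee_fin; case/andP: (e01 a (H M t w)).
by apply: lee_sum => a _; rewrite integral_e// integral_indic.
Qed.

Let S_T t j : (t + j)%N = N -> S_ t j -> T_ t j.
Proof.
move=> e St; have tN : (t <= N)%N by rewrite -e leq_addr.
have qe : {ae Q, forall w a, cmp b (q j (H M t w, a)) (e_ a (H M t w))}.
  by apply: filter_forall => a; exact: ae_qe.
have ew : {ae Q, forall w a, e_ a (H M t w) <= w_ (H M t w)}.
  by apply: filter_forall => a; exact: ae_ew.
move=> B mB; rewrite -integral_w//.
apply: (cmp_integral_of_ae tN mB (mv e) (mw_ tN) (@v01 j t) (@w01 t)).
apply: filterS3 qe ew (ae_wS tN) => w qw ww Sw; apply: sagg ww Sw _ qw.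
by case/andP: (w01 (H M t w)).
Qed.

(** The pair (H_t, A_t) is a component of H_(t+1), so an event in it is an event in H_(t+1), to
    which [T_] applies. *)
Let T_S t j : (t + j.+1)%N = N -> T_ t.+1 j -> S_ t j.+1.
Proof.
move=> e Tt C mC; have [_ _ qE] := qP e.
rewrite qE//.
exact: (Tt _ (measurable_preim measurable_fst mC)).
Qed.

Let S_end : S_ N 0.
Proof.
move=> C mC; have [_ _ qE] := qP (addn0 N).
have mC' := measurable_preim (mHA (leqnn N)) mC.
have mE := measurable_attainable mM N.+1.
have co : seq_consistency M by case: comp.
rewrite (qE _ mC) -(integral_indic Q mC' mE).
have -> : (\int[Q]_(w in HA M N @^-1` C) ((out M w)%:R)%:E =
    \int[Q]_(w in HA M N @^-1` C) (\1_(attainable M N.+1) w)%:E)%E.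
  apply: eq_integral => w _; rewrite indicE; congr (nat_of_bool _)%:R%:E.
  have E := attainable_end w co.
  by apply/idP/idP; [move=> o; apply/mem_set/E|move=> /set_mem/E].
by rewrite /cmp; case: b.
Qed.

Let T_all j t : (t + j)%N = N -> T_ t j.
Proof.
elim: j t => [|j ih] t e; last first.
  by apply: (S_T e); apply: (T_S e); apply: ih; rewrite addSnnS.
apply: (S_T e).
have : t = N by rewrite -e addn0.
by move=> ->; exact: S_end.
Qed.

Lemma cmp_value_V_perfect : cmp b (value P D N agg) (V_perfect Q M).
Proof.
have e0 := add0n N.
have := T_all e0 measurableT; rewrite preimage_setT setIT -V_perfectE//.
rewrite (valueE mdcov mdtrt mdout pos magg agg_01).
have mvH := measurableT_comp (mv e0) (measurable_H mdcov mdtrt (leq0n N)).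
have := integral_transfer mphi QP measurableT mvH (fun x => v01 N (H D 0 x)).
rewrite preimage_setT => <-.
by congr (cmp b (integral _ _ _) _); apply/funext => w /=; rewrite hist_cov_H.
Qed.

End bounds.

(** * Sharpness of the bounds *)

Section selector.
Context {R : realType} {A : nat -> finPointedType}.

(* The event [u \in I_a] for I_a = [low f a, low f a + f a[.  Letting negative u
   belong to every I_a makes it possible to correct u on a null set: u = -1 is
   in all of them and u = 1 in none. *)
Definition in_part (low : forall t, (trt_type A t -> R) -> trt_type A t -> R)
    t (f : trt_type A t -> R) (u : R) (a : trt_type A t) : bool :=
  (u < 0) || (low t f a <= u < low t f a + f a).

(** An interval of length f a is placed inside [0, 1] for each a, in such a way that together these
    intervals fill exactly [0, agg f[. *)
Record selector (agg : forall t, (trt_type A t -> R) -> R)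
    (low : forall t, (trt_type A t -> R) -> trt_type A t -> R) : Prop := Selector {
  measurable_low : forall t d (T : measurableType d) (f : trt_type A t -> T -> R) a,
    (forall a, measurable_fun [set: T] (f a)) ->
    measurable_fun [set: T] (fun w => low t (f^~ w) a) ;
  low_ge0 : forall t (f : trt_type A t -> R) a,
    (forall a, 0 <= f a <= 1) -> 0 <= low t f a ;
  low_le1 : forall t (f : trt_type A t -> R) a,
    (forall a, 0 <= f a <= 1) -> low t f a + f a <= 1 ;
  low_cover : forall t (f : trt_type A t -> R) u,
    (forall a, 0 <= f a <= 1) -> 0 <= u ->
    (exists a, low t f a <= u < low t f a + f a) <-> u < agg t f }.

Lemma in_partP agg low t (f : trt_type A t -> R) u : selector agg low ->
  agg01 agg -> (forall a, 0 <= f a <= 1) ->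
  (exists a, in_part low f u a) <-> u < agg t f.
Proof.
move=> sel agg_01 f01; rewrite /in_part; case: (ltP u 0) => u0 /=.
  split=> [_|_]; last by exists point.
  by apply: (lt_le_trans u0); case/andP: (agg_01 t f f01).
exact: low_cover.
Qed.

Lemma unif_in_part agg low t (f : trt_type A t -> R) a : selector agg low ->
  (forall a, 0 <= f a <= 1) -> unif [set u | in_part low f u a] = (f a)%:E.
Proof.
move=> sel f01; apply: unif_co'; first exact: low_ge0 sel _ _ _ f01.
  by case/andP: (f01 a).
exact: low_le1 sel _ _ _ f01.
Qed.

Definition low_max t (f : trt_type A t -> R) (a : trt_type A t) : R := 0.

Lemma selector_max : selector (@agg_max R A) low_max.
Proof.
split=> [t d T f a mf|t f a f01|t f a f01|t f u f01 u0].
- exact: measurable_cst.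
- by [].
- by rewrite add0r; case/andP: (f01 a).
- rewrite agg_maxP /low_max; split=> -[a ua]; exists a; rewrite add0r u0 in ua *.
    exact: ua.
  exact: ua.
Qed.

Definition cumul t (f : trt_type A t -> R) (a : trt_type A t) : R :=
  \sum_(b <- take (index a (index_enum (trt_type A t))) (index_enum (trt_type A t))) f b.

(** The intervals are laid end to end from 0, and an interval that would overrun 1 is pushed back to
    end at 1. *)
Definition low_sum t (f : trt_type A t -> R) (a : trt_type A t) : R :=
  Num.min (cumul f a) (1 - f a).

Lemma sum_take_nondecreasing (I : Type) (s : seq I) (f : I -> R) n :
  (forall a, 0 <= f a) -> \sum_(b <- take n s) f b <= \sum_(b <- s) f b.
Proof.
move=> f0; rewrite -[in leRHS](cat_take_drop n s) big_cat/= lerDl.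
by apply: sumr_ge0.
Qed.

Lemma cumulS t (f : trt_type A t -> R) a :
  cumul f a + f a = \sum_(b <- take (index a (index_enum (trt_type A t))).+1
    (index_enum (trt_type A t))) f b.
Proof.
have ia : (index a (index_enum (trt_type A t)) < size (index_enum (trt_type A t)))%N.
  by rewrite index_mem mem_index_enum.
by rewrite (take_nth a ia) -cats1 big_cat/= big_seq1 nth_index ?mem_index_enum.
Qed.

Lemma selector_sum : selector (@agg_sum R A) low_sum.
Proof.
have cu0 t (f : trt_type A t -> R) a : (forall a, 0 <= f a <= 1) -> 0 <= cumul f a.
  by move=> f01; apply: sumr_ge0 => b _; case/andP: (f01 b).
split=> [t d T f a mf|t f a f01|t f a f01|t f u f01 u0].
- apply: measurable_minr; first exact: measurable_sum.
  exact: measurable_funB.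
- by rewrite le_min cu0//= subr_ge0; case/andP: (f01 a).
- by rewrite -lerBrDr ge_min lexx orbT.
have f0 a : 0 <= f a by case/andP: (f01 a).
rewrite /agg_sum lt_min; split=> [[a /andP[_]]|/andP[u1 uS]].
  rewrite /low_sum addr_minl subrK lt_min cumulS => /andP[ua ->] /=.
  exact: (lt_le_trans ua (sum_take_nondecreasing _ _ f0)).
have ex : exists n, u < \sum_(b <- take n (index_enum (trt_type A t))) f b.
  by exists (size (index_enum (trt_type A t))); rewrite take_size.
(* The treatment sought is the first whose partial sum exceeds u: by minimality its interval starts
   at or before u, and pushing it back only lowers that start. *)
case: (ex_minnP ex) => -[|n]; first by rewrite take0 big_nil ltNge u0.
move=> un nmin.
have nsize : (n < size (index_enum (trt_type A t)))%N.
  rewrite ltnNge; apply/negP => sn; have := nmin n.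
  by rewrite take_oversize// -(take_oversize (leqW sn)) ltnn => /(_ un).
pose a := nth point (index_enum (trt_type A t)) n.
have ia : index a (index_enum (trt_type A t)) = n.
  by rewrite index_uniq//; exact: index_enum_uniq.
exists a; rewrite /low_sum addr_minl subrK lt_min u1 cumulS ia un !andbT.
have cu : cumul f a <= u.
  by rewrite /cumul ia leNgt; apply/negP => un'; have := nmin _ un'; rewrite ltnn.
by rewrite ge_min cu.
Qed.

End selector.

Section law_lemmas.
Context {R : realType}.
Local Open Scope ereal_scope.

Lemma same_law_trans d (S : measurableType d)
    d1 (T1 : measurableType d1) (P1 : probability T1 R) (X1 : T1 -> S)
    d2 (T2 : measurableType d2) (P2 : probability T2 R) (X2 : T2 -> S)
    d3 (T3 : measurableType d3) (P3 : probability T3 R) (X3 : T3 -> S) :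
  same_law P1 X1 P2 X2 -> same_law P2 X2 P3 X3 -> same_law P1 X1 P3 X3.
Proof. by move=> h12 h23 B mB; rewrite h12// h23. Qed.

Lemma same_law_sym d (S : measurableType d)
    d1 (T1 : measurableType d1) (P1 : probability T1 R) (X1 : T1 -> S)
    d2 (T2 : measurableType d2) (P2 : probability T2 R) (X2 : T2 -> S) :
  same_law P1 X1 P2 X2 -> same_law P2 X2 P1 X1.
Proof. by move=> h12 B mB; rewrite h12. Qed.

Lemma same_law_product_snd d (T : measurableType d) (P : probability T R)
    d0 (S : measurableType d0) (f : T -> S)
    d1 (V1 : measurableType d1) (K1 : probability V1 R)
    d2 (V2 : measurableType d2) (K2 : probability V2 R) (Y : V1 -> V2) :
  measurable_fun [set: T] f -> measurable_fun [set: V1] Y ->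
  same_law K1 Y K2 id ->
  same_law (P \x K1) (fun z => (f z.1, Y z.2)) (P \x K2) (fun z => (f z.1, z.2)).
Proof.
move=> mf mY YK B mB; rewrite [LHS]product1E [RHS]product1E.
apply: eq_integral => x _; exact: (YK _ (measurable_section1 (f x) mB)).
Qed.

Lemma product_eventE d (T : measurableType d) (P : probability T R)
    d1 (V : measurableType d1) (K : probability V R)
    (f : T -> R) (Z : T -> V -> bool) (B : set T) :
  (forall x, K [set u | Z x u] = (f x)%:E) ->
  (P \x K) [set z | B z.1 /\ Z z.1 z.2] = \int[P]_(x in B) (f x)%:E.
Proof.
move=> Zf; rewrite product1E/= [RHS]integral_mkcond/=.
apply: eq_integral => x _; rewrite patchE; case: ifPn; rewrite ?(inE, notin_setE) => Bx.
  by rewrite -[RHS]Zf; congr (K _); apply/seteqP; split=> u /= => [[]|].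
rewrite (_ : [set y | _] = set0) ?measure0//.
by apply/seteqP; split=> u //= [].
Qed.

(** With this one-set pi-system, the law of a pair (X, Z) with Z boolean is determined by the law of
    X and the events on which Z is true. *)
Lemma measurable_boolE : @measurable _ bool = <<s [set [set true]] >>.
Proof.
apply/seteqP; split=> [B _|]; last first.
  by apply: smallest_sub => //; exact: sigma_algebra_measurable.
pose G := [set [set true]]; have GT : <<s G >> [set true] by exact: sub_sigma_algebra.
have GF : <<s G >> [set false].
  rewrite (_ : [set false] = ~` [set true]); first exact: sigma_algebraC.
  by apply/seteqP; split=> -[]//= h; case: (h erefl).
have U (C D : set bool) : <<s G >> C -> <<s G >> D -> <<s G >> (C `|` D).
  exact: (@measurableU _ (g_sigma_algebraType G)).
have G0 : <<s G >> set0 by exact: sigma_algebra0.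
pose C b : set bool := if pselect (B b) then [set b] else set0.
have GC b : <<s G >> (C b) by rewrite /C; case: pselect; case: b.
rewrite (_ : B = C true `|` C false); first exact: U.
apply/seteqP; split=> [[] Bb|[]] /=; rewrite /C.
- by left; case: pselect.
- by right; case: pselect.
- by case: (pselect (B true)) => //; case: (pselect (B false)) => // _ _ [].
- by case: (pselect (B false)) => //; case: (pselect (B true)) => // _ _ [].
Qed.

Lemma same_law_pair_bool d (S : measurableType d)
    d1 (T1 : measurableType d1) (P1 : probability T1 R) (X1 : T1 -> S) (Z1 : T1 -> bool)
    d2 (T2 : measurableType d2) (P2 : probability T2 R) (X2 : T2 -> S) (Z2 : T2 -> bool) :
  measurable_fun [set: T1] X1 -> measurable_fun [set: T2] X2 ->
  measurable_fun [set: T1] Z1 -> measurable_fun [set: T2] Z2 ->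
  same_law P1 X1 P2 X2 ->
  (forall B, measurable B -> P1 [set w | B (X1 w) /\ Z1 w] = P2 [set w | B (X2 w) /\ Z2 w]) ->
  same_law P1 (fun w => (X1 w, Z1 w)) P2 (fun w => (X2 w, Z2 w)).
Proof.
move=> mX1 mX2 mZ1 mZ2 X12 Z12.
apply: (same_law_pair mX1 mX2 mZ1 mZ2 measurable_boolE) => //.
  by move=> _ _ -> ->; rewrite setIid.
by move=> B _ mB ->; exact: Z12.
Qed.

End law_lemmas.

Section noise_laws.
Context {R : realType} (dd : nat -> measure_display)
  (F : forall i, measurableType (dd i)) (K : forall i, probability (F i) R).

(** This is the independence of coordinate i from any f that is unaffected by redrawing it. *)
Lemma ncoord_law n i d (S : measurableType d) (f : noise F n -> S) : (i < n)%N ->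
  measurable_fun [set: noise F n] f -> (forall z, f (@resample _ F n i z) = f z.1) ->
  same_law (noise_law K n) (fun w => (f w, ncoord w i))
    (noise_law K n \x K i)%E (fun z => (f z.1, z.2)).
Proof.
move=> lin mf fr.
have mg : measurable_fun [set: noise F n] (fun w => (f w, ncoord w i)).
  by apply: measurable_fun_pair => //; exact: measurable_ncoord.
have := same_law_sym (same_law_comp mg (@resample_law R _ F K n i lin)).
move=> h B mB; rewrite -[LHS]/((noise_law K n) (((fun w => (f w, ncoord w i)) \o id) @^-1` B)).
rewrite [LHS]h//; congr ((noise_law K n \x K i)%E _).
apply/seteqP.
suff E z : (f (@resample _ F n i z), ncoord (@resample _ F n i z) i) = (f z.1, z.2).
  by split=> z /=; rewrite E.
by rewrite fr ncoord_resample// dfwithin.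
Qed.

End noise_laws.

(** * Conditional independence from invariance under a redraw *)

Section cindep_of_noise.
Context {R : realType} {d d' d'' dx} {T : measurableType d} {S : measurableType d'}
  {U : measurableType d''} {V : measurableType dx}.
Variables (Q : probability T R) (K : probability V R) (r : T * V -> T).
Variables (W : T -> S) (Z : T -> U) (g : S * V -> U).
Hypotheses (mW : measurable_fun [set: T] W) (mZ : measurable_fun [set: T] Z).
Hypothesis mg : measurable_fun [set: S * V] g.
Hypothesis rQ : same_law (Q \x K)%E r Q id.
Hypothesis rW : forall z, W (r z) = W z.1.
Hypothesis rZ : forall z, Z (r z) = g (W z.1, z.2).

(** After the redraw Z is g(W, x) with x fresh, whereas W and E are unchanged. Hence the probability
    of Z \in B given W is [pi], the K-measure of the x with g(W, x) \in B, and it stays so on E. *)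
Lemma cindep_of_noise (G : set (set T)) :
  (forall E, G E -> measurable E) -> (forall E z, G E -> E (r z) <-> E z.1) ->
  cindep Q W Z G.
Proof.
move=> mG rG B E mB GE.
have mE : measurable E.
  move: E GE; apply: smallest_sub => //; exact: sigma_algebra_measurable.
have rE z : E (r z) <-> E z.1.
  (* The sets invariant under r form a sigma-algebra, so invariance passes from the generators to
     E. *)
  pose I : set (set T) := [set E | forall z, E (r z) <-> E z.1].
  suff GI : <<s G >> `<=` I by exact: GI.
  apply: smallest_sub => [|E' GE' y]; last exact: rG.
  split=> [y //|C IC y|F IF y].
    by split=> -[_ nC]; split=> // ?; apply: nC; apply/IC.
  by split=> -[i _ Fi]; exists i => //; apply/(IF i).
pose pi (s : S) : R := fine (K [set x | B (g (s, x))]).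
have mgB : measurable (g @^-1` B) := measurable_preim mg mB.
have piE s : (pi s)%:E = K [set x | B (g (s, x))].
  by rewrite fineK// fin_num_measure//; exact: (measurable_section1 s mgB).
have pi01 s : 0 <= pi s <= 1.
  rewrite -!lee_fin piE measure_ge0 probability_le1//.
  exact: (measurable_section1 s mgB).
have mpi : measurable_fun [set: S] pi.
  apply: measurableT_comp => //.
  exact: (@measurable_prob_section1 _ _ _ _ _ K (g @^-1` B)).
have mZB := measurable_preim mZ mB.
(* With the full space as E' this identifies [pi] as a conditional probability; with E itself it
   yields the factorisation. *)
have intpi E' C : measurable E' -> (forall z, E' (r z) <-> E' z.1) -> measurable C ->
    Q ((Z @^-1` B `&` E') `&` W @^-1` C) =
    (\int[Q]_(w in W @^-1` C `&` E') (pi (W w))%:E)%E.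
  move=> mE' rE' mC; have mWC := measurable_preim mW mC.
  rewrite -(rQ (measurableI _ _ (measurableI _ _ mZB mE') mWC)).
  rewrite -(@product_eventE _ _ _ Q _ _ K (pi \o W)
    (fun w x => `[< B (g (W w, x)) >]) (W @^-1` C `&` E')); last first.
    move=> w; rewrite piE; congr (K _).
    by apply/seteqP; split=> x /=; rewrite asboolE.
  congr ((Q \x K)%E _); apply/seteqP; split=> z /=.
    rewrite rW rZ asboolE => -[[Bz Ez] Cz]; split=> //; split=> //; exact/rE'.
  rewrite rW rZ asboolE => -[[Cz Ez] Bz]; split=> //; split=> //; exact/rE'.
have cpi : is_cexp Q W \1_(Z @^-1` B) pi.
  split=> //.
    exact: (integrable01 Q measurableT (measurableT_comp mpi mW) (fun w => pi01 (W w))).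
  move=> C mC; have mWC := measurable_preim mW mC.
  have TT z : [set: T] (r z) <-> [set: T] z.1 by [].
  by have := intpi setT C measurableT TT mC; rewrite !setIT => <-; rewrite integral_indic.
have mZE := measurableI _ _ mZB mE.
have c01 : forall w, 0 <= (\1_E w : R) <= 1 by move=> w; rewrite indicE ler0n lern1 leq_b1.
pose e := clamp \o cprob Q W E.
have ce : is_cexp Q W \1_E e.
  exact: (is_cexp_clamp mW (measurable_indic mE) c01 (cprobP Q mW mE)).
have e01 s : 0 <= e s <= 1 by rewrite clamp_ge0 clamp_le1.
have me : measurable_fun [set: S] e by case: ce.
have cpe : is_cexp Q W \1_(Z @^-1` B `&` E) (fun s => e s * pi s).
  have mepi : measurable_fun [set: S] (fun s => e s * pi s) by exact: measurable_funM.
  split=> //.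
    apply: (integrable01 Q measurableT (measurableT_comp mepi mW)) => w.
    by case/andP: (e01 (W w)) (pi01 (W w)) => ? ? /andP[? ?]; rewrite mulr_ge0// mulr_ile1.
  move=> C mC; have mWC := measurable_preim mW mC.
  by rewrite (is_cexp_pull_out mW mE ce e01 mpi pi01 mC) -(intpi E C mE rE mC)
    integral_indic.
have u1 := is_cexp_unique mW (cprobP Q mW mZE) cpe.
have u2 := is_cexp_unique mW (cprobP Q mW mZB) cpi.
have u3 := is_cexp_unique mW (cprobP Q mW mE) ce.
by apply: filterS3 u1 u2 u3 => w -> -> ->; rewrite mulrC.
Qed.

End cindep_of_noise.

(** * The extremal joint law *)

Section construction.
Context {R : realType} {A : nat -> finPointedType} {k : nat -> nat} {N : nat}.
Variable P : probability (data R A k N) R.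
Notation D := (data_process R A k N).
Hypothesis pos : seq_positivity P D N.
Variable agg : forall t, (trt_type A t -> R) -> R.
Variable low : forall t, (trt_type A t -> R) -> trt_type A t -> R.
Hypotheses (magg : measurable_agg agg) (agg_01 : agg01 agg).
Hypothesis sel : selector agg low.

Let q t : hist R A k t * trt_type A t -> R := qclamp P D agg (N - t) (t := t).
Let v t : hist R A k t -> R := vclamp P D agg (N - t) (t := t).

Let mdcov n t (_ : (t <= n)%N) := @measurable_data_cov R A k N t.
Let mdtrt n t (_ : (t <= n)%N) := @measurable_data_trt R A k N t.
Let mdout := @measurable_data_out R A k N.

Let mH t : measurable_fun [set: data R A k N] (H D t).
Proof. exact: (measurable_H (@mdcov t) (@mdtrt t)). Qed.

Let mHA t : measurable_fun [set: data R A k N] (HA D t).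
Proof. exact: (measurable_HA (@mdcov t) (@mdtrt t)). Qed.

Let mq t : (t <= N)%N -> measurable_fun [set: hist R A k t * trt_type A t] (@q t).
Proof.
move=> tN; apply: (measurable_qclamp (@mdcov N) (@mdtrt N) mdout pos magg agg_01).
by rewrite subnKC.
Qed.

Let mv t : (t <= N)%N -> measurable_fun [set: hist R A k t] (@v t).
Proof.
move=> tN; apply: (measurable_vclampP (@mdcov N) (@mdtrt N) mdout pos magg agg_01).
by rewrite subnKC.
Qed.

Let q01 t z : 0 <= @q t z <= 1. Proof. exact: qclamp01. Qed.
Let v01 t h : 0 <= @v t h <= 1. Proof. exact: vclamp01. Qed.

Let q_target t : (t <= N)%N -> is_cexp P (HA D t)
  (fun x => if (t < N)%N then v (H D t.+1 x) else (out D x)%:R) (@q t).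
Proof.
move=> tN; have e : (t + (N - t))%N = N by rewrite subnKC.
have [_ _ + _] := qclampP (@mdcov N) (@mdtrt N) mdout pos magg agg_01 e.
congr is_cexp; apply/funext => x; case: ltnP => [tN'|Nt]; last first.
  by have -> : (N - t)%N = 0%N by apply/eqP; rewrite subn_eq0.
by rewrite -{1}(subnSK tN').
Qed.

Notation U := (measurableTypeR R).

Definition success t (x : hist R A k t * U) (a : trt_type A t) : bool :=
  in_part low (fun a => q (x.1, a)) x.2 a.

Lemma measurable_success t d (T : measurableType d) (x : T -> hist R A k t * U)
    (a : T -> trt_type A t) : (t <= N)%N ->
  measurable_fun [set: T] x -> measurable_fun [set: T] a ->
  measurable_fun [set: T] (fun w => success (x w) (a w)).
Proof.
move=> tN mx ma.
apply: (measurable_discrete_index (f := fun b w => success (x w) b)) ma => b.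
have mx1 : measurable_fun [set: T] (fun w => (x w).1) by exact: measurableT_comp.
have mx2 : measurable_fun [set: T] (fun w => (x w).2) by exact: measurableT_comp.
have mqx c : measurable_fun [set: T] (fun w => q ((x w).1, c)).
  exact: (measurableT_comp (mq tN) (measurable_fun_pair mx1 (measurable_cst c))).
have ml : measurable_fun [set: T] (fun w => low (fun c => q ((x w).1, c)) b).
  exact: (measurable_low sel (f := fun c w => q ((x w).1, c)) b mqx).
apply: measurable_or; first exact: measurable_fun_ltr.
apply: measurable_and; first exact: measurable_fun_ler.
by apply: measurable_fun_ltr => //; exact: measurable_funD.
Qed.

Lemma success_ex t (x : hist R A k t * U) : (exists a, success x a) <-> x.2 < v x.1.
Proof. exact: (in_partP _ sel agg_01 (fun a => q01 (x.1, a))). Qed.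

Lemma unif_success t h a : unif [set u | @success t (h, u) a] = (q (h, a))%:E.
Proof. exact: (unif_in_part a sel (fun a => q01 (h, a))). Qed.

Let PU : probability (data R A k N * U)%type R := (P \x unif)%E.
(* The event [u_(t+1) < v_(t+1)(H_(t+1))] for a uniform u_(t+1). *)
Let promising t (x : data R A k N * U) : bool := x.2 < v (H D t.+1 x.1).

Let mpromising t : (t < N)%N -> measurable_fun [set: data R A k N * U] (promising t).
Proof.
move=> tN; apply: measurable_fun_ltr => //; apply: (measurableT_comp (mv tN)).
exact: measurableT_comp.
Qed.

Variable choose : forall t, hist R A k t * U -> trt_type A t.
Hypothesis mchoose : forall t, measurable_fun [set: hist R A k t * U] (@choose t).
Hypothesis chooseP : forall t, same_law P (fun x => (H D t x, trt D t x))
  (P \x unif)%E (fun z => (H D t z.1, choose (H D t z.1, z.2))).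

(** Conditioning on the constant [tt] makes this an unconditional draw of (L_0, u_0). *)
Variable first : unit * tnoise R (k 0) -> cov_type R k 0 * U.
Hypothesis mfirst : measurable_fun [set: unit * tnoise R (k 0)] first.
Hypothesis firstP : same_law PU (fun x => (tt, (cov D 0 x.1, x.2)))
  (PU \x tnoise_law R (k 0))%E (fun z => (tt, first (tt, z.2))).

(** The sampler is calibrated with the bit [promising], which looks ahead to u_(t+1); in [step] it
    is fed with the bit [success], which is known at time t. *)
Variable next : forall t, (hist R A k t * trt_type A t * bool) * tnoise R (k t.+1) ->
  cov_type R k t.+1 * U.
Hypothesis mnext : forall t, (t < N)%N -> measurable_fun
  [set: (hist R A k t * trt_type A t * bool) * tnoise R (k t.+1)] (@next t).
Hypothesis nextP : forall t, (t < N)%N ->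
  same_law PU (fun x => ((H D t x.1, trt D t x.1, promising t x), (cov D t.+1 x.1, x.2)))
    (PU \x tnoise_law R (k t.+1))%E
    (fun z => ((H D t z.1.1, trt D t z.1.1, promising t z.1),
               next ((H D t z.1.1, trt D t z.1.1, promising t z.1), z.2))).

(* The correction is void on the observed path; because of it, [step_lt] holds on
   every path, so that no null set of counterfactual paths has to be excluded. *)
Definition adjust (z : bool) (u x : R) : R :=
  if (u < x) == z then u else if z then -1 else 1.

Lemma adjust_lt z u x : 0 <= x <= 1 -> (adjust z u x < x) = z.
Proof.
move=> /andP[x0 x1]; rewrite /adjust; case: eqP => // _; case: z.
  by rewrite (lt_le_trans _ x0)// ltrN10.
by rewrite ltNge x1.
Qed.

Definition assemble t (y : (hist R A k t * trt_type A t * bool) *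
    (cov_type R k t.+1 * U)) : hist R A k t.+1 * U :=
  ((y.1.1, y.2.1), adjust y.1.2 y.2.2 (v ((y.1.1, y.2.1) : hist R A k t.+1))).

Lemma measurable_assemble t : (t < N)%N -> measurable_fun setT (@assemble t).
Proof.
move=> tN.
have m1 : measurable_fun [set: (hist R A k t * trt_type A t * bool) *
    (cov_type R k t.+1 * U)] (fun y => (y.1.1, y.2.1)).
  by apply: measurable_fun_pair; exact: measurableT_comp.
apply: measurable_fun_pair => //.
have m2 : measurable_fun [set: (hist R A k t * trt_type A t * bool) *
    (cov_type R k t.+1 * U)] (fun y => v ((y.1.1, y.2.1) : hist R A k t.+1)).
  exact: (measurableT_comp (mv tN) m1).
have m3 : measurable_fun [set: (hist R A k t * trt_type A t * bool) *
    (cov_type R k t.+1 * U)] (fun y => y.1.2) by exact: measurableT_comp.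
have m4 : measurable_fun [set: (hist R A k t * trt_type A t * bool) *
    (cov_type R k t.+1 * U)] (fun y => y.2.2) by exact: measurableT_comp.
apply: measurable_fun_ifT => //; last exact: measurable_fun_ifT.
have mlt := measurable_fun_ltr m4 m2.
rewrite (_ : (fun y => _) = (fun y : (hist R A k t * trt_type A t * bool) *
    (cov_type R k t.+1 * U) => if y.1.2 then (y.2.2 < v ((y.1.1, y.2.1) : hist R A k t.+1))
   else ~~ (y.2.2 < v ((y.1.1, y.2.1) : hist R A k t.+1)))).
  by apply: measurable_fun_ifT => //; exact: measurable_neg.
by apply/funext => y; case: y.1.2; case: (_ < _).
Qed.

Definition step t (x : hist R A k t * U) (a : trt_type A t) (xi : tnoise R (k t.+1)) :
    hist R A k t.+1 * U :=
  assemble ((x.1, a, success x a), next ((x.1, a, success x a), xi)).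

Lemma step_lt t (x : hist R A k t * U) a xi :
  ((step x a xi).2 < v (step x a xi).1) = success x a.
Proof. exact: adjust_lt. Qed.

Lemma measurable_step t d (T : measurableType d) (x : T -> hist R A k t * U)
    (a : T -> trt_type A t) (xi : T -> tnoise R (k t.+1)) : (t < N)%N ->
  measurable_fun [set: T] x -> measurable_fun [set: T] a ->
  measurable_fun [set: T] xi ->
  measurable_fun [set: T] (fun w => step (x w) (a w) (xi w)).
Proof.
move=> tN mx ma mxi.
have mz : measurable_fun [set: T] (fun w => ((x w).1, a w, success (x w) (a w))).
  apply: measurable_fun_pair; last exact: measurable_success (ltnW tN) mx ma.
  by apply: measurable_fun_pair => //; exact: measurableT_comp.
apply: (measurableT_comp (measurable_assemble tN)); apply: measurable_fun_pair => //.
exact: (measurableT_comp (mnext tN) (measurable_fun_pair mz mxi)).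
Qed.

(* The first component drives A_i and the second one L_i and u_i. *)
Let F1 (i : nat) : measurableType _ := U.
Let F2 (i : nat) : measurableType _ := tnoise R (k i).
Let F i : measurableType _ := (F1 i * F2 i)%type.
Let K1 (i : nat) : probability (F1 i) R := unif.
Let K2 (i : nat) : probability (F2 i) R := tnoise_law R (k i).
Let K i : probability (F i) R := (K1 i \x K2 i)%E.
Let Omega := noise F N.+1.
Let Q : probability Omega R := noise_law K N.+1.

Let alpha i (w : Omega) : U := (ncoord w i).1.
Let xi i (w : Omega) : tnoise R (k i) := (ncoord w i).2.

Let malpha i : measurable_fun setT (alpha i).
Proof. exact: (measurableT_comp measurable_fst (@measurable_ncoord _ F N.+1 i)). Qed.

Let mxi i : measurable_fun setT (xi i).
Proof. exact: (measurableT_comp measurable_snd (@measurable_ncoord _ F N.+1 i)). Qed.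

(** All branches share the covariate noise [xi]. No [alpha] enters, which makes exchangeability hold
    for the branches jointly. *)
Fixpoint cf_state (t : nat) : tseq A t -> Omega -> hist R A k t * U :=
  if t is t'.+1 return tseq A t -> Omega -> hist R A k t * U
  then fun s w => step (cf_state s.1 w) s.2 (xi t'.+1 w)
  else fun _ w => first (tt, xi 0 w).

Fixpoint obs_state (t : nat) (w : Omega) : hist R A k t * U :=
  if t is t'.+1 return hist R A k t * U
  then step (obs_state t' w) (choose ((obs_state t' w).1, alpha t' w)) (xi t'.+1 w)
  else first (tt, xi 0 w).

Let action t (w : Omega) : trt_type A t := choose ((obs_state t w).1, alpha t w).

Definition last_cov (t : nat) : hist R A k t -> cov_type R k t :=
  if t is t'.+1 return hist R A k t -> cov_type R k t then snd else id.

Definition model : cf_process R A k N Omega := CfProcess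
  (Process (fun t w => last_cov (obs_state t w).1) action
     (fun w => success (obs_state N w) (action N w)))
  (fun t s w => (cf_state s w).1.2)
  (fun s w => success (cf_state s.1 w) s.2).

Lemma H_model t w : H model t w = (obs_state t w).1.
Proof. by elim: t => //= t ->. Qed.

Lemma cf_hist_model t (s : tseq A t) w : cf_hist model s w = (cf_state s w).1.
Proof. by elim: t s => //= t ih [s a]; rewrite ih. Qed.

Lemma cf_state_obs t w : cf_state (obs_seq model t w) w = obs_state t w.
Proof. by elim: t => //= t ->. Qed.

Lemma consistency_model : seq_consistency model.
Proof.
split=> [t tN s w <-|s w <-]; first by rewrite cf_hist_model cf_state_obs H_model.
by rewrite /= cf_state_obs.
Qed.

Lemma measurable_cf_state t (s : tseq A t) : (t <= N)%N ->
  measurable_fun setT (cf_state s).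
Proof.
elim: t s => [|t ih] s tN.
  by apply: (measurableT_comp mfirst); apply: measurable_fun_pair.
exact: (measurable_step tN (ih s.1 (ltnW tN)) (measurable_cst s.2) (@mxi t.+1)).
Qed.

Lemma measurable_obs_state t : (t <= N)%N -> measurable_fun setT (obs_state t).
Proof.
elim: t => [|t ih] tN.
  by apply: (measurableT_comp mfirst); apply: measurable_fun_pair.
have mt := ih (ltnW tN).
apply: measurable_step => //; apply: (measurableT_comp (@mchoose t)).
by apply: measurable_fun_pair => //; exact: measurableT_comp.
Qed.

Let maction t : (t <= N)%N -> measurable_fun setT (action t).
Proof.
move=> tN; have mt := measurable_obs_state tN.
apply: (measurableT_comp (@mchoose t)).
by apply: measurable_fun_pair => //; exact: measurableT_comp.
Qed.

Lemma measurable_model : measurable_process model.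
Proof.
split=> /=.
- move=> t tN; have m1 := measurableT_comp measurable_fst (measurable_obs_state tN).
  apply: (measurableT_comp (f := @last_cov t)) => //.
  case: t {tN m1} => [|t] /=; [exact: measurable_id|exact: measurable_snd].
- exact: maction.
- exact: measurable_success (leqnn N) (measurable_obs_state (leqnn N)) (maction (leqnn N)).
- move=> t tN s; have m1 := measurableT_comp measurable_fst (measurable_cf_state (t := t.+1) s tN).
  exact: (measurableT_comp measurable_snd m1).
- move=> s; apply: measurable_success => //; exact: measurable_cf_state.
Qed.

Lemma eq_cf_state t (s : tseq A t) w w' :
  (forall i, (i <= t)%N -> xi i w = xi i w') -> cf_state s w = cf_state s w'.
Proof.
elim: t s => [|t ih] s xiE /=; first by rewrite xiE.
by rewrite xiE// (ih s.1)// => i it; exact/xiE/leqW.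
Qed.

Lemma eq_obs_state t w w' : (forall i, (i <= t)%N -> xi i w = xi i w') ->
  (forall i, (i < t)%N -> alpha i w = alpha i w') -> obs_state t w = obs_state t w'.
Proof.
elim: t => [|t ih] xiE alE /=; first by rewrite xiE.
rewrite xiE// alE// ih// => i it; first exact/xiE/leqW.
exact/alE/ltnW.
Qed.

Let eq_action t w w' : (forall i, (i <= t)%N -> xi i w = xi i w') ->
  (forall i, (i <= t)%N -> alpha i w = alpha i w') -> action t w = action t w'.
Proof.
move=> xiE alE; rewrite /action alE//; congr (choose (_.1, _)).
by apply: eq_obs_state => // i it; exact/alE/ltnW.
Qed.

Let redraw t (z : Omega * U) : Omega := @resample1 _ _ F1 F2 N.+1 t z.

Let ncoord_redraw t z i : (i < N.+1)%N -> ncoord (redraw t z) i =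
  @dfwith _ (fun i => F i : Type) (ncoord z.1) t (z.2, (ncoord z.1 t).2) i.
Proof. exact: ncoord_resample. Qed.

Let xi_redraw t z i : (i <= N)%N -> xi i (redraw t z) = xi i z.1.
Proof.
move=> iN; rewrite /xi ncoord_redraw//.
by have [<-|ti] := eqVneq t i; [rewrite dfwithin|rewrite dfwithout].
Qed.

Let alpha_redraw t z i : (i <= N)%N -> i != t -> alpha i (redraw t z) = alpha i z.1.
Proof. by move=> iN it; rewrite /alpha ncoord_redraw// dfwithout// eq_sym. Qed.

Let alpha_redraw_same t z : (t <= N)%N -> alpha t (redraw t z) = z.2.
Proof. by move=> tN; rewrite /alpha ncoord_redraw// dfwithin. Qed.

Let obs_state_redraw t z i : (t <= N)%N -> (i <= t)%N ->
  obs_state i (redraw t z) = obs_state i z.1.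
Proof.
move=> tN it; apply: eq_obs_state => j ji.
  by rewrite xi_redraw// (leq_trans ji)// (leq_trans it).
rewrite alpha_redraw//; first by rewrite ltnW// (leq_trans ji)// (leq_trans it).
by rewrite ltn_eqF// (leq_trans ji).
Qed.

Let action_redraw t z i : (t <= N)%N -> (i < t)%N ->
  action i (redraw t z) = action i z.1.
Proof.
move=> tN it; apply: eq_action => j ji.
  by rewrite xi_redraw// (leq_trans ji)// (leq_trans (ltnW it)).
rewrite alpha_redraw//; first by rewrite (leq_trans ji)// (leq_trans (ltnW it)).
by rewrite ltn_eqF// (leq_ltn_trans ji).
Qed.

Let cf_state_redraw t z n (s : tseq A n) : (n <= N)%N ->
  cf_state s (redraw t z) = cf_state s z.1.
Proof.
by move=> nN; apply: eq_cf_state => i it; rewrite xi_redraw// (leq_trans it).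
Qed.

Let splice_redraw t z n (s : tseq A n) : (t <= N)%N ->
  splice model t (redraw t z) s = splice model t z.1 s.
Proof.
move=> tN; apply: eq_tseq => i iN; rewrite !tseq_nth_splice//.
by case: ltnP => // it /=; exact: action_redraw.
Qed.

(** Redrawing [alpha t] affects neither the state at t nor the earlier treatments spliced into the
    future events, while the action becomes [choose] of H_t and the fresh value. *)
Lemma exchangeability_model : strong_seq_exchangeability Q model.
Proof.
move=> t tN; have HE : H model t = fun w => (obs_state t w).1.
  by apply/funext => w; exact: H_model.
have mst := measurable_obs_state tN.
rewrite HE; apply: (@cindep_of_noise _ _ _ _ _ _ _ _ _ Q unif (redraw t) _ _
  (@choose t)) => //.
- exact: measurableT_comp.
- exact: maction.
- exact: (@resample1_law _ _ _ F1 F2 K1 K2 N.+1 t).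
- by move=> z; rewrite obs_state_redraw.
- by move=> z; rewrite /= /action obs_state_redraw// alpha_redraw_same.
- by move=> E; exact: (measurable_future_events measurable_model).
move=> E z [[n [s [B [/andP[tn nN] mB ->]]]]|[s [b ->]]]; rewrite /mkset.
  rewrite (_ : cf_hist _ _ _ = cf_hist model (splice model t z.1 s) z.1)//.
  by rewrite !cf_hist_model splice_redraw// cf_state_redraw.
rewrite (_ : cf_out _ _ _ = cf_out model (splice model t z.1 s) z.1)//.
by rewrite splice_redraw//; congr (success _ _); rewrite cf_state_redraw.
Qed.

(** [success_ex] removes the last treatment and [step_lt] turns the resulting inequality into a
    success one step earlier; alternating them descends to time 0, for every w. *)
Lemma attainable_model w : attainable model 0 w <->
  (first (tt, xi 0 w)).2 < @v 0 (first (tt, xi 0 w)).1.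
Proof.
rewrite attainable0.
have succ t : (exists s : tseq A t.+1, success (cf_state s.1 w) s.2) <->
    exists s : tseq A t, (cf_state s w).2 < v (cf_state s w).1.
  split=> [[[s a] /= sa]|[s /success_ex[a sa]]]; last by exists (s, a).
  by exists s; apply/success_ex; exists a.
have stp t : (exists s : tseq A t.+1, (cf_state s w).2 < v (cf_state s w).1) <->
    exists s : tseq A t.+1, success (cf_state s.1 w) s.2.
  by split=> -[s sw]; exists s; move: sw; rewrite /= step_lt.
rewrite /= (succ N).
elim: N => [|n ih]; first by split=> [[]|h]; [|exists tt].
by rewrite stp succ.
Qed.

Let obs_state_law t : Prop :=
  same_law Q (obs_state t) PU (fun x => (H D t x.1, x.2)).

Let obs_state_law0 : obs_state_law 0.
Proof.
have inv (z : Omega * F 0) : (fun=> tt) (@resample _ F N.+1 0 z) = (fun=> tt) z.1 by [].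
have h := @ncoord_law _ _ F K N.+1 0 _ _ (fun=> tt) (ltn0Sn N) (measurable_cst _) inv.
have m1 : measurable_fun [set: unit * F 0] (fun y => first (tt, y.2.2)).
  apply: (measurableT_comp mfirst); apply: measurable_fun_pair => //.
  exact: (measurableT_comp measurable_snd measurable_snd).
move=> B mB.
have -> := same_law_comp m1 h mB.
have mf : measurable_fun [set: tnoise R (k 0)] (fun y => first (tt, y)).
  exact: (measurableT_comp mfirst (pair1_measurable tt)).
have mB' := measurable_preim mf mB.
have h2 := product_snd Q (K 0) (measurable_preim measurable_snd mB').
apply: (eq_trans h2 (eq_trans (product_snd (K1 0) (K2 0) mB') _)).
have h3 := same_law_comp measurable_snd firstP mB.
exact: (eq_trans (esym (product_snd PU (tnoise_law R (k 0)) mB')) (esym h3)).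
Qed.

Let action_law t : (t <= N)%N -> obs_state_law t ->
  same_law Q (fun w => (obs_state t w, action t w))
    PU (fun x => ((H D t x.1, x.2), trt D t x.1)).
Proof.
move=> tN It; have mst := measurable_obs_state tN.
pose c (y : (hist R A k t * U) * U) := (y.1, choose (y.1.1, y.2)).
have mc : measurable_fun setT c.
  apply: measurable_fun_pair => //; apply: (measurableT_comp (@mchoose t)).
  by apply: measurable_fun_pair => //; exact: measurableT_comp.
have mxa : measurable_fun setT (fun w => (obs_state t w, alpha t w)).
  exact: measurable_fun_pair.
have mHu : measurable_fun setT (fun x : data R A k N * U => (H D t x.1, x.2)).
  by apply: measurable_fun_pair => //; exact: measurableT_comp.
have mHc : measurable_fun setT (fun z : data R A k N * U => (H D t z.1, choose (H D t z.1, z.2))).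
  apply: measurable_fun_pair; first exact: measurableT_comp.
  exact: (measurableT_comp (@mchoose t) mHu).
pose rr (y : (hist R A k t * trt_type A t) * U) := ((y.1.1, y.2), y.1.2).
have mrr : measurable_fun setT rr.
  apply: measurable_fun_pair; last exact: measurableT_comp.
  by apply: measurable_fun_pair => //; exact: measurableT_comp.
move=> B mB.
have h1 := same_law_comp mxa (@resample1_law _ _ _ F1 F2 K1 K2 N.+1 t tN)
  (measurable_preim mc mB).
have h3 := same_law_comp mc (same_law_product unif mst mHu It) mB.
have h5 := same_law_comp mrr (same_law_product unif (@mHA t) mHc (@chooseP t)) mB.
have mB4 : measurable ((fun z : (data R A k N * U) * U =>
    ((H D t z.1.1, z.2), choose (H D t z.1.1, z.1.2))) @^-1` B).
  apply: measurable_preim mB; apply: measurable_fun_pair.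
    apply: measurable_fun_pair => //; apply: (measurableT_comp (@mH t)).
    exact: measurableT_comp.
  exact: (measurableT_comp (measurableT_comp measurable_snd mHc)).
(* u_t and the treatment noise are both uniform factors; exchanging them brings the latter next to
   H_t, where [chooseP] applies. *)
have h4 := @product_swapA _ _ _ P _ _ unif _ _ unif _ mB4.
rewrite -[LHS]h1.
transitivity ((Q \x unif)%E
  ((c \o (fun z => (obs_state t z.1, z.2))) @^-1` B)).
  congr ((Q \x unif)%E _); apply/seteqP.
  suff E z : (obs_state t (redraw t z), alpha t (redraw t z)) = (obs_state t z.1, z.2).
    by split=> z; rewrite /preimage/= -/(redraw t z); have := E z => -[-> ->].
  by congr (_, _); [exact: obs_state_redraw|exact: alpha_redraw_same].
by rewrite [LHS]h3 [LHS]h4 -[LHS]h5.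
Qed.

(** Since u_t is uniform and independent of (H_t, A_t), the bit [success] has conditional
    probability q_t(H_t, A_t). So has any Z with the regression target as conditional mean, and a
    bit is determined in law by that probability. *)
Let success_law t (Z : data R A k N * U -> bool) : (t <= N)%N -> obs_state_law t ->
  measurable_fun setT Z ->
  (forall C, measurable C -> PU [set x | C (HA D t x.1) /\ Z x] =
    (\int[P]_(x in HA D t @^-1` C)
      (if (t < N)%N then v (H D t.+1 x) else (out D x)%:R)%:E)%E) ->
  same_law Q (fun w => ((obs_state t w).1, action t w, success (obs_state t w) (action t w)))
    PU (fun x => (H D t x.1, trt D t x.1, Z x)).
Proof.
move=> tN It mZ PZ.
pose f (y : (hist R A k t * U) * trt_type A t) := (y.1.1, y.2, success y.1 y.2).
have mf : measurable_fun setT f.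
  apply: measurable_fun_pair; last exact: measurable_success.
  by apply: measurable_fun_pair => //; exact: measurableT_comp.
have mHA1 : measurable_fun setT (fun x : data R A k N * U => (H D t x.1, trt D t x.1)).
  exact: (measurableT_comp (@mHA t)).
have mHu : measurable_fun setT (fun x : data R A k N * U => (H D t x.1, x.2)).
  by apply: measurable_fun_pair => //; exact: measurableT_comp.
have mtrt1 : measurable_fun setT (fun x : data R A k N * U => trt D t x.1).
  exact: (measurableT_comp measurable_snd mHA1).
have h : same_law PU (fun x => (H D t x.1, trt D t x.1, success (H D t x.1, x.2) (trt D t x.1)))
    PU (fun x => (H D t x.1, trt D t x.1, Z x)).
  apply: (same_law_pair_bool mHA1 mHA1 (measurable_success tN mHu mtrt1) mZ
    (fun _ _ => erefl)).
  move=> C mC; rewrite [RHS](PZ _ mC).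
  have [_ _ <-//] := q_target tN.
  apply: (@product_eventE _ _ _ P _ _ unif (fun x => q (HA D t x))
    (fun x u => success (H D t x, u) (trt D t x)) (HA D t @^-1` C)) => x.
  exact: unif_success.
exact: (same_law_trans (same_law_comp mf (action_law tN It)) h).
Qed.

Let obs_state_lawS t : (t < N)%N -> obs_state_law t -> obs_state_law t.+1.
Proof.
move=> tN It.
pose f w := ((obs_state t w).1, action t w, success (obs_state t w) (action t w)).
pose g (x : data R A k N * U) := (H D t x.1, trt D t x.1, promising t x).
have fg : same_law Q f PU g.
  apply: success_law => //; [exact: ltnW|exact: mpromising|].
  move=> C mC; rewrite tN.
  apply: (@product_eventE _ _ _ P _ _ unif (fun x => v (H D t.+1 x))
    (fun x u => u < v (H D t.+1 x)) (HA D t @^-1` C)) => x.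
  exact: unif_lt.
have mst := measurable_obs_state (ltnW tN).
have mf : measurable_fun setT f.
  apply: measurable_fun_pair; last first.
    exact: (measurable_success (ltnW tN) mst (maction (ltnW tN))).
  apply: measurable_fun_pair; last exact: (maction (ltnW tN)).
  exact: measurableT_comp.
have mg : measurable_fun setT g.
  apply: measurable_fun_pair; last exact: mpromising.
  exact: (measurableT_comp (@mHA t)).
(* Everything up to the action at t ignores coordinate t+1, whose noise is therefore fresh for the
   next step. *)
have finv (z : Omega * F t.+1) : f (@resample _ F N.+1 t.+1 z) = f z.1.
  have E i : (i <= t)%N -> ncoord (@resample _ F N.+1 t.+1 z) i = ncoord z.1 i.
    by move=> it; rewrite ncoord_resample ?dfwithout ?gtn_eqF// ltnS (leq_trans it (ltnW tN)).
  have xiE i : (i <= t)%N -> xi i (@resample _ F N.+1 t.+1 z) = xi i z.1.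
    by move=> it; rewrite /xi E.
  have alE i : (i <= t)%N -> alpha i (@resample _ F N.+1 t.+1 z) = alpha i z.1.
    by move=> it; rewrite /alpha E.
  by rewrite /f (eq_action xiE alE) (eq_obs_state xiE)// => i it; exact/alE/ltnW.
pose c (y : (hist R A k t * trt_type A t * bool) * F t.+1) :=
  assemble (y.1, next (y.1, y.2.2)).
pose c' (y : (hist R A k t * trt_type A t * bool) * tnoise R (k t.+1)) :=
  assemble (y.1, next (y.1, y.2)).
have mc' : measurable_fun setT c'.
  apply: (measurableT_comp (measurable_assemble tN)); apply: measurable_fun_pair => //.
  by apply: (measurableT_comp (mnext tN)); exact: measurable_fun_pair.
have mc : measurable_fun setT c.
  have m : measurable_fun [set: (hist R A k t * trt_type A t * bool) * F t.+1]
      (fun y => (y.1, y.2.2)).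
    apply: measurable_fun_pair => //.
    exact: (measurableT_comp measurable_snd measurable_snd).
  exact: (measurableT_comp mc' m).
move=> B mB.
have h1 := same_law_comp mc (@ncoord_law _ _ F K N.+1 t.+1 _ _ f tN mf finv) mB.
have snd_law : same_law (K t.+1) snd (K2 t.+1) id := @product_snd _ _ _ (K1 t.+1) _ _ (K2 t.+1).
have h2 := same_law_comp mc' (same_law_product_snd Q mf measurable_snd snd_law) mB.
have h3 := same_law_comp mc' (same_law_product (K2 t.+1) mf mg fg) mB.
have h4 := same_law_comp (measurable_assemble tN) (nextP tN) mB.
rewrite [LHS]h1 [LHS]h2 [LHS]h3 -[LHS]h4.
congr (PU _); apply/seteqP.
(* Here the bit is the very comparison tested by [adjust], so no correction takes place. *)
suff E (x : data R A k N * U) : assemble (g x, (cov D t.+1 x.1, x.2)) = (H D t.+1 x.1, x.2).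
  by split=> x; rewrite /preimage/= -/(g x) E.
by rewrite /assemble /adjust /= eqxx.
Qed.

Let obs_state_lawP t : (t <= N)%N -> obs_state_law t.
Proof.
elim: t => [_|t ih tN]; first exact: obs_state_law0.
exact/obs_state_lawS/ih/ltnW.
Qed.

Lemma law_model B : measurable B -> Q (observe model N @^-1` B) = P B.
Proof.
move=> mB.
have oE : observe model N =
    fun w => ((obs_state N w).1, action N w, success (obs_state N w) (action N w)).
  by apply/funext => w; rewrite /observe H_model.
have mout1 : measurable_fun setT (fun x : data R A k N * U => out D x.1).
  exact: (measurableT_comp mdout).
(* At the last time the bit compared with [success] is Y itself. *)
rewrite oE (success_law (leqnn N) (obs_state_lawP (leqnn N)) mout1 _ mB).
  rewrite -[LHS]/(PU (fst @^-1` ((observe D N) @^-1` B))).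
  rewrite (_ : observe D N = id); first exact: product_fst.
  by apply/funext => x; exact: observe_data.
move=> C mC; rewrite ltnn.
have mHC := measurable_preim (@mHA N) mC.
have mo : measurable (out D @^-1` [set true]) by exact: measurable_preim.
transitivity (P (out D @^-1` [set true] `&` HA D N @^-1` C)).
  rewrite -(product_fst P unif (measurableI _ _ mo mHC)).
  by congr (PU _); apply/seteqP; split=> x [].
rewrite -integral_indic//; apply: eq_integral => x _.
rewrite indicE; congr (nat_of_bool _)%:R%:E.
by apply/idP/idP => [/set_mem//|/mem_set].
Qed.

Lemma compatible_model : compatible Q model P.
Proof.
split; [exact: measurable_model|exact: law_model|exact: consistency_model|].
exact: exchangeability_model.
Qed.

Lemma V_perfect_model : V_perfect Q model = value P D N agg.
Proof.
rewrite (V_perfectE measurable_model).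
have e0 : (0 + N)%N = N by [].
rewrite (valueE (@mdcov N) (@mdtrt N) mdout pos magg agg_01).
have mv0 := mv (leq0n N).
have mB : measurable [set y : hist R A k 0 * U | y.2 < v y.1].
  apply: measurable_pred; apply: measurable_fun_ltr => //.
  exact: (measurableT_comp mv0).
transitivity (PU [set x | setT x.1 /\ x.2 < v (H D 0 x.1)]).
  transitivity (Q (obs_state 0 @^-1` [set y | y.2 < v y.1])).
    by congr (Q _); apply/seteqP; split=> w /attainable_model.
  rewrite (obs_state_lawP (leq0n N) mB); congr (PU _).
  by apply/seteqP; split=> x //= [].
rewrite [LHS](@product_eventE _ _ _ P _ _ unif (fun x => v (H D 0 x))
  (fun x u => u < v (H D 0 x)) setT); last by move=> x; exact: unif_lt.
by rewrite /v subn0.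
Qed.

End construction.

Lemma exists_model (R : realType) (A : nat -> finPointedType) (k : nat -> nat)
    (N : nat) (P : probability (data R A k N) R)
    (agg : forall t, (trt_type A t -> R) -> R)
    (low : forall t, (trt_type A t -> R) -> trt_type A t -> R) :
  seq_positivity P (data_process R A k N) N ->
  measurable_agg agg -> agg01 agg -> selector agg low ->
  exists (d : measure_display) (T : measurableType d) (Q : probability T R)
    (M : cf_process R A k N T),
    compatible Q M P /\ V_perfect Q M = value P (data_process R A k N) N agg.
Proof.
move=> pos magg agg_01 sel; pose D := data_process R A k N.
have mcov n t (_ : (t <= n)%N) := @measurable_data_cov R A k N t.
have mtrt n t (_ : (t <= n)%N) := @measurable_data_trt R A k N t.
have mH t : measurable_fun setT (H D t) := measurable_H (@mcov t) (@mtrt t) (leqnn t).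
have choose t := cid2 (outsourced_discrete P (mH t) (@measurable_data_trt R A k N t)).
pose PU : probability (data R A k N * measurableTypeR R)%type R := (P \x unif)%E.
have mcovU t : measurable_fun setT
    (fun x : data R A k N * measurableTypeR R => (cov D t x.1, x.2)).
  apply: measurable_fun_pair => //.
  exact: (measurableT_comp (@measurable_data_cov R A k N t)).
have first := cid2 (outsourced_tuple PU (measurable_cst tt) (mcovU 0)).
pose promising t (x : data R A k N * measurableTypeR R) :=
  x.2 < vclamp P D agg (N - t.+1) (H D t.+1 x.1).
have next t : {G : (hist R A k t * trt_type A t * bool) * tnoise R (k t.+1) ->
      cov_type R k t.+1 * measurableTypeR R |
    (t < N)%N -> measurable_fun setT G /\
    same_law PU (fun x => ((H D t x.1, trt D t x.1, promising t x), (cov D t.+1 x.1, x.2)))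
      (PU \x tnoise_law R (k t.+1))%E
      (fun z => ((H D t z.1.1, trt D t z.1.1, promising t z.1),
                 G ((H D t z.1.1, trt D t z.1.1, promising t z.1), z.2)))}.
  (* From time N on a constant stands in for the sampler, since v is known to be measurable only up
     to time N. *)
  apply: cid; case: (ltnP t N) => [tN|_]; last by exists (fun=> point).
  have mW : measurable_fun setT (fun x : data R A k N * measurableTypeR R =>
      (H D t x.1, trt D t x.1, promising t x)).
    apply: measurable_fun_pair.
      apply: measurable_fun_pair; first exact: (measurableT_comp (mH t)).
      exact: (measurableT_comp (@measurable_data_trt R A k N t)).
    apply: measurable_fun_ltr => //.
    apply: (measurableT_comp (f := vclamp P D agg (N - t.+1) (t := t.+1))).
      apply: (measurable_vclampP (@mcov N) (@mtrt N) (@measurable_data_out R A k N)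
        pos magg agg_01).
      by rewrite subnKC.
    exact: (measurableT_comp (mH t.+1)).
  by have [G mG GP] := outsourced_tuple PU mW (mcovU t.+1); exists G.
pose ch t := s2val (choose t).
pose fi := s2val first.
pose ne t := sval (next t).
have mch t : measurable_fun setT (ch t) := s2valP (choose t).
have chP t := s2valP' (choose t).
have mfi : measurable_fun setT fi := s2valP first.
have fiP := s2valP' first.
have mne t (tN : (t < N)%N) : measurable_fun setT (ne t) := (svalP (next t) tN).1.
have neP t (tN : (t < N)%N) := (svalP (next t) tN).2.
eexists _, _, _, (model P agg low ch fi ne); split.
  exact: (@compatible_model R A k N P pos agg low magg agg_01 sel ch mch chP fi mfi fiP ne mne neP).
exact: (@V_perfect_model R A k N P pos agg low magg agg_01 sel ch mch chP fi mfi fiP ne mne neP).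
Qed.

Theorem theorem1 (R : realType) (A : nat -> finPointedType) (k : nat -> nat)
    (N : nat) (P : probability (data R A k N) R) :
  seq_positivity P (data_process R A k N) N ->
  [/\ forall (d : measure_display) (T : measurableType d)
        (Q : probability T R) (M : cf_process R A k N T),
        compatible Q M P ->
        (V_minus P (data_process R A k N) N <= V_perfect Q M
           <= V_plus P (data_process R A k N) N)%E,
      exists (d : measure_display) (T : measurableType d)
        (Q : probability T R) (M : cf_process R A k N T),
        compatible Q M P /\ V_perfect Q M = V_minus P (data_process R A k N) N &
      exists (d : measure_display) (T : measurableType d)
        (Q : probability T R) (M : cf_process R A k N T),
        compatible Q M P /\ V_perfect Q M = V_plus P (data_process R A k N) N].
Proof.
move=> pos; split.
- move=> d T Q M comp; apply/andP; split.
    exact: (cmp_value_V_perfect comp pos (@measurable_agg_max R A) agg_max01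
      (@sandwich_max R A)).
  exact: (cmp_value_V_perfect comp pos (@measurable_agg_sum R A) agg_sum01
    (@sandwich_sum R A)).
- exact: (exists_model pos (@measurable_agg_max R A) agg_max01 (@selector_max R A)).
- exact: (exists_model pos (@measurable_agg_sum R A) agg_sum01 (@selector_sum R A)).
Qed.
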